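(* Let $k$ be a field. If $G$ is a finite simple graph with no chordless even cycle, then $G$ is sequentially $S_2$ (over $k$).
   Context: A finitely generated graded module $M$ over a Noetherian graded $k$-algebra $R$ satisfies Serre's condition $S_r$ if $\operatorname{depth} M_{\mathfrak p}\ge \min(r,\dim M_{\mathfrak p})$ for all $\mathfrak p\in\operatorname{Spec}(R)$. A finitely generated $\mathbb Z$-graded $R$-module $M$ ($R$ a standard graded $k$-algebra) is sequentially $S_r$ if there is a finite filtration $0=M_0\subset M_1\subset\cdots\subset M_t=M$ by graded submodules such that each quotient $M_i/M_{i-1}$ satisfies $S_r$ and $\dim(M_1/M_0)<\dim(M_2/M_1)<\cdots<\dim(M_t/M_{t-1})$. A simplicial complex $\Delta$ on $[n]=\{1,\dots,n\}$ is sequentially $S_r$ over $k$ if its face ring $k[\Delta]=k[x_1,\dots,x_n]/I_\Delta$ is sequentially $S_r$ as a module over $R=k[x_1,\dots,x_n]$; here $I_\Delta$ is the Stanley-Reisner ideal, generated by the squarefree monomials $\prod_{j\in F}x_j$ with $F\notin\Delta$. For a finite simple graph $G$, $\Delta_G$ is the simplicial complex on the vertex set of $G$ whose faces are the independent sets of vertices of $G$; $G$ is called sequentially $S_r$ if $\Delta_G$ is. *)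

(* Defs.v *)
From HB Require Import structures.
From mathcomp Require Import all_boot all_order all_algebra.
From mathcomp Require Import generic_quotient ring_quotient.
(* mpoly has to be loaded before constructive_ereal (notation levels). *)
From mathcomp Require Import mpoly.
From mathcomp Require Import ring.
From mathcomp Require Import boolp constructive_ereal.

Set Implicit Arguments.
Unset Strict Implicit.
Unset Printing Implicit Defensive.

Import Order.TTheory GRing.Theory Num.Theory.
Local Open Scope ring_scope.
Local Open Scope quotient_scope.

(* Supremum in Z u {-oo, +oo} of the set of natural numbers P; the supremum of
   the empty set is -oo. *)
Definition nat_sup (P : nat -> Prop) : \bar int :=
  if pselect (exists d, P d /\ forall e, P e -> (e <= d)%N) is left maxP then
    ((projT1 (cid maxP))%:Z)%:E
  else if `[< exists d, P d >] then +oo%E else -oo%E.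

Section QuotientModule.
Variables (R : comNzRingType) (M : lmodType R) (N : submodClosed M).

(* A submodClosed predicate is not canonically a zmodClosed one, which is what
   Quotient.quot expects; submod_pred provides the latter. *)
Definition submod_pred : {pred M} := fun x => x \in N.

HB.instance Definition _ :=
  GRing.isSubmodClosed.Build R M submod_pred (submodClosedP N).

Definition quotmod := Quotient.quot submod_pred.

HB.instance Definition _ := GRing.Zmodule.on quotmod.

Definition quotmod_pi (x : M) : quotmod := \pi_(Quotient.quot submod_pred) x.

Lemma quotmod_eq x y : (quotmod_pi x = quotmod_pi y) <-> (x - y \in N).
Proof.
rewrite -[x - y \in N]/(x - y \in submod_pred) Quotient.idealrBE.
by split=> [xy|/eqP //]; apply/eqP.
Qed.

Lemma quotmod_piK (q : quotmod) : quotmod_pi (repr (q : Quotient.quot submod_pred)) = q.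
Proof. exact: reprK. Qed.

Lemma quotmod_piP (q : quotmod) : exists x, q = quotmod_pi x.
Proof. by exists (repr (q : Quotient.quot submod_pred)); rewrite quotmod_piK. Qed.

Lemma quotmod_piB : zmod_morphism quotmod_pi.
Proof. exact: pi_is_zmod_morphism. Qed.

HB.instance Definition _ :=
  GRing.isZmodMorphism.Build M quotmod quotmod_pi quotmod_piB.

Definition quotmod_scale (a : R) (q : quotmod) : quotmod :=
  quotmod_pi (a *: repr (q : Quotient.quot submod_pred)).

Lemma quotmod_scaleE a x : quotmod_scale a (quotmod_pi x) = quotmod_pi (a *: x).
Proof.
apply/quotmod_eq; rewrite -scalerBr rpredZ //.
by apply/quotmod_eq; rewrite quotmod_piK.
Qed.

Lemma quotmod_scalerA a b q :
  quotmod_scale a (quotmod_scale b q) = quotmod_scale (a * b) q.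
Proof. by rewrite -(quotmod_piK q) !quotmod_scaleE scalerA. Qed.

Lemma quotmod_scale1r : left_id 1 quotmod_scale.
Proof. by move=> q; rewrite -(quotmod_piK q) quotmod_scaleE scale1r. Qed.

Lemma quotmod_scalerDr : right_distributive quotmod_scale +%R.
Proof.
move=> a q r; rewrite -(quotmod_piK q) -(quotmod_piK r) -raddfD !quotmod_scaleE.
by rewrite scalerDr raddfD.
Qed.

Lemma quotmod_scalerDl q : {morph quotmod_scale^~ q : a b / a + b}.
Proof.
by move=> a b; rewrite -(quotmod_piK q) !quotmod_scaleE scalerDl raddfD.
Qed.

HB.instance Definition _ := GRing.Zmodule_isLmodule.Build R quotmod
  quotmod_scalerA quotmod_scale1r quotmod_scalerDr quotmod_scalerDl.

Lemma quotmod_pi_scalable : scalable quotmod_pi.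
Proof. by move=> a x; rewrite -quotmod_scaleE. Qed.

HB.instance Definition _ :=
  GRing.isScalable.Build R M quotmod _ quotmod_pi quotmod_pi_scalable.

End QuotientModule.

Section Subquotient.
Variables (R : comNzRingType) (M : lmodType R) (N L : submodClosed M).

Definition submodule := {x : M | x \in N}.

HB.instance Definition _ := SubType.on submodule.
HB.instance Definition _ := [Choice of submodule by <:].
HB.instance Definition _ := [SubChoice_isSubLmodule of submodule by <:].

Definition submod_trace : {pred submodule} := fun x => val x \in L.

Lemma submod_trace_closed : submod_closed submod_trace.
Proof.
split=> [|a x y xL yL]; rewrite unfold_in ?raddf0 ?rpred0 //.
by rewrite /submod_trace GRing.valD GRing.valZ rpredD ?rpredZ.
Qed.

HB.instance Definition _ :=
  GRing.isSubmodClosed.Build R submodule submod_trace submod_trace_closed.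

(* N / (N :&: L), i.e., N / L when L is contained in N *)
Definition subquot := quotmod submod_trace.

HB.instance Definition _ := GRing.Lmodule.on subquot.

End Subquotient.

Section Localization.
Variables (R : comNzRingType) (p : prime_idealr R).

Definition denom := {s : R | s \notin p}.

HB.instance Definition _ := SubType.on denom.
HB.instance Definition _ := Choice.on denom.

Lemma denom1_subproof : 1 \notin p. Proof. by rewrite idealr1. Qed.
Definition denom1 : denom := exist _ 1 denom1_subproof.

Lemma denomM_subproof (s t : denom) : sval s * sval t \notin p.
Proof. by rewrite prime_idealrM negb_or (valP s) (valP t). Qed.
Definition denomM (s t : denom) : denom := exist (fun r => r \notin p) _ (denomM_subproof s t).

Section Module.
Variable M : lmodType R.

Definition loc_equiv (x y : M * denom) : bool :=
  `[< exists u : denom,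
      sval u *: (sval y.2 *: x.1) = sval u *: (sval x.2 *: y.1) >].

Lemma loc_equivP : equiv_class_of loc_equiv.
Proof.
split=> [x|x y|y x z].
- by apply/asboolP; exists denom1.
- by apply/asboolP/asboolP => -[u uP]; exists u.
move=> /asboolP[u uP] /asboolP[v vP]; apply/asboolP.
exists (denomM (denomM u v) y.2) => /=.
move: uP vP; rewrite !scalerA => uP vP.
have -> : sval u * sval v * sval y.2 * sval z.2 =
          (sval v * sval z.2) * (sval u * sval y.2) by ring.
have -> : sval u * sval v * sval y.2 * sval x.2 =
          (sval u * sval x.2) * (sval v * sval y.2) by ring.
rewrite -scalerA uP -[in RHS]scalerA -vP !scalerA.
by congr (_ *: _); ring.
Qed.

Canonical loc_equiv_equiv := EquivRelPack loc_equivP.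
Canonical loc_equiv_encModRel := defaultEncModRel loc_equiv.

Definition loc := {eq_quot loc_equiv}.

HB.instance Definition _ := Choice.on loc.

Definition frac (m : M) (s : denom) : loc := \pi_({eq_quot loc_equiv}) (m, s).

Lemma frac_eq m s n t :
  frac m s = frac n t <->
  exists u : denom, sval u *: (sval t *: m) = sval u *: (sval s *: n).
Proof. by split=> [/eqmodP/asboolP|uP]; last exact/eqmodP/asboolP. Qed.

Definition locnum (x : loc) : M := (repr (x : {eq_quot loc_equiv})).1.
Definition locden (x : loc) : denom := (repr (x : {eq_quot loc_equiv})).2.

Lemma fracK x : frac (locnum x) (locden x) = x.
Proof. by rewrite /frac -surjective_pairing; exact: reprK. Qed.

Definition loc_zero : loc := frac 0 denom1.
Definition loc_opp (x : loc) : loc := frac (- locnum x) (locden x).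
Definition loc_add (x y : loc) : loc :=
  frac (sval (locden y) *: locnum x + sval (locden x) *: locnum y)
       (denomM (locden x) (locden y)).

Lemma loc_oppE m s : loc_opp (frac m s) = frac (- m) s.
Proof.
apply/frac_eq; have /frac_eq[u uP] := fracK (frac m s).
by exists u; rewrite !scalerN uP.
Qed.

Lemma loc_addE m s n t : loc_add (frac m s) (frac n t) =
  frac (sval t *: m + sval s *: n) (denomM s t).
Proof.
apply/frac_eq; have /frac_eq[u] := fracK (frac m s).
have /frac_eq[v] := fracK (frac n t); rewrite !scalerA /= => vP uP.
set m' := locnum _ in uP *; set s' := locden _ in uP *.
set n' := locnum _ in vP *; set t' := locden _ in vP *.
exists (denomM u v) => /=; rewrite !scalerDr !scalerA; congr (_ + _).
- have -> : sval u * sval v * (sval s * sval t) * sval t' =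
            sval v * sval t * sval t' * (sval u * sval s) by ring.
  by rewrite -scalerA uP scalerA; congr (_ *: _); ring.
- have -> : sval u * sval v * (sval s * sval t) * sval s' =
            sval u * sval s * sval s' * (sval v * sval t) by ring.
  by rewrite -scalerA vP scalerA; congr (_ *: _); ring.
Qed.

Lemma loc_addA : associative loc_add.
Proof.
move=> x y z; rewrite -(fracK x) -(fracK y) -(fracK z) !loc_addE.
by apply/frac_eq; exists denom1; rewrite /= !scalerDr !scalerA;
  rewrite addrA; congr (_ *: _ + _ *: _ + _ *: _); ring.
Qed.

Lemma loc_addC : commutative loc_add.
Proof.
move=> x y; rewrite -(fracK x) -(fracK y) !loc_addE.
by apply/frac_eq; exists denom1; rewrite addrC /= [sval (locden y) * _]mulrC.
Qed.

Lemma loc_add0 : left_id loc_zero loc_add.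
Proof.
move=> x; rewrite -(fracK x) loc_addE; apply/frac_eq; exists denom1 => /=.
by rewrite scaler0 add0r !scalerA; congr (_ *: _); ring.
Qed.

Lemma loc_addN : left_inverse loc_zero loc_opp loc_add.
Proof.
move=> x; rewrite -(fracK x) loc_oppE loc_addE; apply/frac_eq.
by exists denom1; rewrite scalerN addNr !scaler0.
Qed.

HB.instance Definition _ :=
  GRing.isZmodule.Build loc loc_addA loc_addC loc_add0 loc_addN.

Lemma fracD m s n t :
  frac m s + frac n t = frac (sval t *: m + sval s *: n) (denomM s t).
Proof. exact: loc_addE. Qed.

End Module.

Definition locring := loc R^o.

HB.instance Definition _ := GRing.Zmodule.on locring.

Definition locfrac (a : R) (s : denom) : locring := frac (a : R^o) s.

Lemma locfracE (x : locring) : locfrac (locnum x) (locden x) = x.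
Proof. exact: fracK. Qed.

Lemma locfrac_eq a s b t : locfrac a s = locfrac b t <->
  exists u : denom, sval u * (sval t * a) = sval u * (sval s * b).
Proof. exact: frac_eq. Qed.

Lemma locfracD a s b t :
  locfrac a s + locfrac b t = locfrac (sval t * a + sval s * b) (denomM s t).
Proof. exact: fracD. Qed.

Section Scale.
Variable M : lmodType R.

Definition loc_scale (x : locring) (y : loc M) : loc M :=
  frac ((locnum x : R) *: locnum y) (denomM (locden x) (locden y)).

Lemma loc_scaleE a s m t :
  loc_scale (locfrac a s) (frac m t) = frac (a *: m) (denomM s t).
Proof.
apply/frac_eq; have /locfrac_eq[u] := locfracE (locfrac a s).
have /frac_eq[v] := fracK (frac m t); rewrite !scalerA /= => vP uP.
set a' := (locnum (locfrac a s) : R) in uP *; set s' := locden _ in uP *.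
set m' := locnum _ in vP *; set t' := locden _ in vP *.
exists (denomM u v) => /=; rewrite !scalerA.
have -> : sval u * sval v * (sval s * sval t * a') =
          sval u * (sval s * a') * (sval v * sval t) by ring.
by rewrite -scalerA vP uP scalerA; congr (_ *: _); ring.
Qed.

End Scale.

Definition locring_one : locring := locfrac 1 denom1.
Definition locring_mul (x y : locring) : locring := @loc_scale R^o x y.

Lemma locring_mulE a s b t :
  locring_mul (locfrac a s) (locfrac b t) = locfrac (a * b) (denomM s t).
Proof. exact: loc_scaleE. Qed.

Lemma locring_mulA : associative locring_mul.
Proof.
move=> x y z; rewrite -(locfracE x) -(locfracE y) -(locfracE z) !locring_mulE.
by apply/locfrac_eq; exists denom1 => /=; ring.
Qed.

Lemma locring_mulC : commutative locring_mul.
Proof.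
move=> x y; rewrite -(locfracE x) -(locfracE y) !locring_mulE.
by apply/locfrac_eq; exists denom1 => /=; ring.
Qed.

Lemma locring_mul1 : left_id locring_one locring_mul.
Proof.
move=> x; rewrite -(locfracE x) locring_mulE.
by apply/locfrac_eq; exists denom1 => /=; ring.
Qed.

Lemma locring_mulDl : left_distributive locring_mul +%R.
Proof.
move=> x y z; rewrite -(locfracE x) -(locfracE y) -(locfracE z).
rewrite locfracD !locring_mulE locfracD.
by apply/locfrac_eq; exists denom1 => /=; ring.
Qed.

Lemma locring_one_neq0 : locring_one != 0.
Proof.
apply/eqP => /locfrac_eq[u] /=; rewrite mul1r mulr0 mulr1 mulr0 => u0.
by have := svalP u; rewrite u0 rpred0.
Qed.

HB.instance Definition _ := GRing.Zmodule_isComNzRing.Build locring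
  locring_mulA locring_mulC locring_mul1 locring_mulDl locring_one_neq0.

Lemma locfracM a s b t :
  locfrac a s * locfrac b t = locfrac (a * b) (denomM s t).
Proof. exact: locring_mulE. Qed.

Section LocModule.
Variable M : lmodType R.

Lemma loc_scalerA (x y : locring) (z : loc M) :
  loc_scale x (loc_scale y z) = loc_scale (x * y) z.
Proof.
rewrite -(locfracE x) -(locfracE y) -(fracK z) locfracM !loc_scaleE.
apply/frac_eq; exists denom1; rewrite /= !scalerA.
by congr (_ *: _); ring.
Qed.

Lemma loc_scale1r : left_id 1 (@loc_scale M).
Proof.
move=> z; rewrite -(fracK z) loc_scaleE; apply/frac_eq; exists denom1.
by rewrite /= !scalerA; congr (_ *: _); ring.
Qed.

Lemma loc_scalerDr : right_distributive (@loc_scale M) +%R.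
Proof.
move=> x y z; rewrite -(locfracE x) -(fracK y) -(fracK z).
rewrite fracD !loc_scaleE fracD; apply/frac_eq; exists denom1 => /=.
by rewrite !scalerDr !scalerA; congr (_ *: _ + _ *: _); ring.
Qed.

Lemma loc_scalerDl z : {morph (@loc_scale M)^~ z : x y / x + y}.
Proof.
move=> x y; rewrite -(locfracE x) -(locfracE y) -(fracK z).
rewrite locfracD !loc_scaleE fracD; apply/frac_eq; exists denom1 => /=.
by rewrite scalerDl !scalerDr !scalerA; congr (_ *: _ + _ *: _); ring.
Qed.

HB.instance Definition _ := GRing.Zmodule_isLmodule.Build locring (loc M)
  loc_scalerA loc_scale1r loc_scalerDr loc_scalerDl.

Lemma fracZ a s (m : M) t :
  locfrac a s *: frac m t = frac (a *: m) (denomM s t).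
Proof. exact: loc_scaleE. Qed.

End LocModule.

Definition locmax : {pred locring} :=
  fun x => `[< exists a s, a \in p /\ x = locfrac a s >].

End Localization.

Arguments locmax {R} p _.

Section DimDepth.
Variables (A : comNzRingType) (M : lmodType A).

(* Krull dimension of A / Ann M, via chains P_0 < ... < P_d of primes that
   contain Ann M; it is -oo when M = 0. *)
Definition dim : \bar int := nat_sup (fun d =>
  exists P : nat -> prime_idealr A,
    (forall a, (forall m : M, a *: m = 0) -> a \in P 0) /\
    (forall i, (i < d)%N ->
       {subset P i <= P i.+1} /\ exists2 a, a \in P i.+1 & a \notin P i)).

(* m \in (x_1, ..., x_r) M, which is 0 when r = 0 *)
Definition in_seqmod (xs : seq A) (m : M) : Prop :=
  exists c : nat -> M, m = \sum_(i < size xs) xs`_i *: c i.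

Definition regular_seq (xs : seq A) : Prop :=
  (forall i m, (i < size xs)%N ->
     in_seqmod (take i xs) (xs`_i *: m) -> in_seqmod (take i xs) m) /\
  (exists m, ~ in_seqmod xs m).

(* Meant for a local ring A with maximal ideal I. With this definition
   depth 0 = -oo rather than the usual +oo; this is immaterial below, where
   depth M is only bounded from below by dim M, and dim 0 = -oo. *)
Definition depth (I : {pred A}) : \bar int := nat_sup (fun d =>
  exists xs : seq A,
    [/\ size xs = d, {subset xs <= I} & regular_seq xs]).

End DimDepth.

Definition serre (r : nat) (R : comNzRingType) (M : lmodType R) : Prop :=
  forall p : prime_idealr R,
    (Order.min (r%:Z)%:E (dim (loc p M)) <= depth (loc p M) (locmax p))%E.

Record gradedModule (k : fieldType) (n : nat) := GradedModule {
  gmod :> lmodType {mpoly k[n]};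
  gcomp : int -> {pred gmod};
  _ : forall i, zmod_closed (gcomp i);
  _ : forall d i f m, f \is d.-homog -> m \in gcomp i ->
        f *: m \in gcomp (d%:Z + i);
  _ : forall m, exists (s : seq int) (c : int -> gmod),
        (forall i, c i \in gcomp i) /\ m = \sum_(i <- s) c i;
  _ : forall (s : seq int) (c : int -> gmod),
        uniq s -> (forall i, c i \in gcomp i) -> \sum_(i <- s) c i = 0 ->
        forall i, i \in s -> c i = 0;
  _ : exists gens : seq gmod, forall m, exists a : nat -> {mpoly k[n]},
        m = \sum_(i < size gens) a i *: gens`_i }.

Section Sequentially.
Variables (k : fieldType) (n : nat) (M : gradedModule k n).

Definition graded_submodule (N : submodClosed M) : Prop :=
  forall m, m \in N -> exists (s : seq int) (c : int -> M),
    (forall i, c i \in gcomp i /\ c i \in N) /\ m = \sum_(i <- s) c i.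

Definition sequentially_S (r : nat) : Prop :=
  exists (t : nat) (F : nat -> submodClosed M),
    [/\ F 0 =i pred1 0 /\ F t =i predT,
        forall i, (i <= t)%N -> graded_submodule (F i),
        forall i, (i < t)%N ->
          {subset F i <= F i.+1} /\ exists2 m, m \in F i.+1 & m \notin F i,
        forall i, (i < t)%N -> serre r (subquot (F i.+1) (F i))
      & forall i, (i.+1 < t)%N ->
          (dim (subquot (F i.+1) (F i)) <
           dim (subquot (F i.+2) (F i.+1)))%E].

End Sequentially.

Record simplicialComplex (n : nat) := SimplicialComplex {
  faces :> {set {set 'I_n}};
  _ : forall F G : {set 'I_n}, G \in faces -> F \subset G -> F \in faces }.

Section FaceRing.
Variables (k : fieldType) (n : nat) (D : simplicialComplex n).

Local Notation S := {mpoly k[n]}.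

Definition sqfree (F : {set 'I_n}) : S := \prod_(j in F) 'X_j.

Definition SR_ideal : {pred S^o} := fun f =>
  `[< exists c : {set 'I_n} -> S,
        f = \sum_(F | F \notin faces D) c F * sqfree F >].

Lemma SR_ideal_closed : submod_closed SR_ideal.
Proof.
split=> [|a x y /asboolP[c ->] /asboolP[d ->]]; apply/asboolP.
  by exists (fun=> 0); rewrite big1 // => F _; rewrite mul0r.
exists (fun F => a * c F + d F); rewrite /GRing.scale /= mulr_sumr -big_split.
by apply: eq_bigr => F _ /=; rewrite mulrDl mulrA.
Qed.

HB.instance Definition _ :=
  GRing.isSubmodClosed.Build S S^o SR_ideal SR_ideal_closed.

Definition face_ring := quotmod SR_ideal.

HB.instance Definition _ := GRing.Lmodule.on face_ring.

Definition face_pi (f : S) : face_ring := quotmod_pi SR_ideal (f : S^o).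

Lemma face_pi0 f : (face_pi f = 0) <-> (f : S^o) \in SR_ideal.
Proof.
rewrite -[0]/(0 : quotmod _) -(raddf0 (quotmod_pi SR_ideal)).
by rewrite quotmod_eq subr0.
Qed.

Lemma face_piZ (f g : S) : f *: face_pi g = face_pi (f * g).
Proof. by rewrite -[RHS]/(quotmod_pi _ (f *: (g : S^o))) linearZ. Qed.

Lemma face_pi_sum (I : Type) (s : seq I) (P : pred I) (c : I -> S) :
  face_pi (\sum_(i <- s | P i) c i) = \sum_(i <- s | P i) face_pi (c i).
Proof. exact: (raddf_sum (quotmod_pi SR_ideal)). Qed.

Lemma face_piP (q : face_ring) : exists f, q = face_pi f.
Proof. exact: (quotmod_piP (q : quotmod SR_ideal)). Qed.

Lemma SR_ideal_sum (I : Type) (s : seq I) (P : pred I) (c : I -> S) :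
  (forall i, P i -> (c i : S^o) \in SR_ideal) ->
  (\sum_(i <- s | P i) c i : S^o) \in SR_ideal.
Proof. by move=> cP; apply: (@rpred_sum S^o SR_ideal). Qed.

Lemma sqfreeE F : sqfree F = 'X_[(\sum_(j in F) U_(j))%MM].
Proof. by rewrite /sqfree -mprodXE. Qed.

Lemma SR_idealMl a f : (f : S^o) \in SR_ideal -> (a * f : S^o) \in SR_ideal.
Proof. exact: (@rpredZ S S^o SR_ideal). Qed.

Lemma sqfree_SR F : F \notin faces D -> (sqfree F : S^o) \in SR_ideal.
Proof.
move=> FD; apply/asboolP; exists (fun G => (G == F)%:R).
rewrite (bigD1 F) //= eqxx mul1r big1 ?addr0 // => G /andP[_ /negPf ->].
by rewrite mul0r.
Qed.

Lemma SR_ideal_homog d f :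
  (f : S^o) \in SR_ideal -> (pihomog mdeg d f : S^o) \in SR_ideal.
Proof.
move=> /asboolP[c ->]; rewrite raddf_sum; apply: SR_ideal_sum => F FD /=.
rewrite {1}[c F]mpolyE mulr_suml raddf_sum; apply: SR_ideal_sum => m _ /=.
rewrite -scalerAl linearZ sqfreeE -mpolyXD /= pihomogX -mul_mpolyC.
apply: SR_idealMl; case: ifP => _; last exact: (@rpred0 S^o SR_ideal).
by rewrite mpolyXD -sqfreeE; apply/SR_idealMl/sqfree_SR.
Qed.

(* f is homogeneous of degree i, where S has no elements of negative degree *)
Definition homog_of (i : int) (f : S) : bool :=
  if i is Posz d then f \is d.-homog else f == 0.

Definition face_comp (i : int) : {pred face_ring} :=
  fun q => `[< exists2 f, homog_of i f & q = face_pi f >].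

Lemma face_comp_closed i : zmod_closed (face_comp i).
Proof.
split=> [|x y /asboolP[f fi ->] /asboolP[g gi ->]]; apply/asboolP.
  exists 0; last by apply/esym/face_pi0; exact: (@rpred0 S^o SR_ideal).
  by case: i => i /=; rewrite ?eqxx ?dhomog0.
exists (f - g); last exact/esym/(raddfB (quotmod_pi SR_ideal)).
case: i fi gi => i /=; first exact: rpredB.
by move=> /eqP -> /eqP ->; rewrite subr0.
Qed.

Lemma face_comp_scale d i f (m : face_ring) :
  f \is d.-homog -> m \in face_comp i -> f *: m \in face_comp (d%:Z + i).
Proof.
move=> fd /asboolP[g gi ->]; apply/asboolP; exists (f * g).
  case: i gi => i /=; first exact: dhomogM.
  move=> /eqP ->; rewrite mulr0 /homog_of.
  by case: (_ + _) => j; rewrite ?dhomog0 ?eqxx.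
exact: face_piZ.
Qed.

Lemma face_comp_span (m : face_ring) :
  exists (s : seq int) (c : int -> face_ring),
    (forall i, c i \in face_comp i) /\ m = \sum_(i <- s) c i.
Proof.
have [f ->] := face_piP m.
pose c (i : int) := face_pi (if i is Posz d then pihomog mdeg d f else 0).
exists [seq Posz d | d <- iota 0 (msize f)], c; split=> [i|].
  apply/asboolP; eexists; last by reflexivity.
  by case: i => i /=; rewrite ?pihomogP.
rewrite big_map -[X in iota _ X]subn0 big_mkord /c -face_pi_sum.
by rewrite -(pihomog_partitionE (mf := mdeg)).
Qed.

Lemma face_comp_direct (s : seq int) (c : int -> face_ring) :
  uniq s -> (forall i, c i \in face_comp i) -> \sum_(i <- s) c i = 0 ->
  forall i, i \in s -> c i = 0.
Proof.
move=> us cP sum0 i si.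
have /choice[g gP] : forall i, exists f, homog_of i f /\ c i = face_pi f.
  by move=> j; have /asboolP[f ? ?] := cP j; exists f.
rewrite (gP i).2; apply/face_pi0; have := (gP i).1.
case: i si => d si /=; last by move=> /eqP ->; exact: (@rpred0 S^o SR_ideal).
move=> gd; have : (\sum_(j <- s) g j : S^o) \in SR_ideal.
  apply/face_pi0; rewrite face_pi_sum -[RHS]sum0.
  by apply: eq_bigr => j _; rewrite (gP j).2.
move=> /(SR_ideal_homog d); rewrite raddf_sum (bigD1_seq (Posz d)) //=.
rewrite pihomog_dE // big1 ?addr0 // => j jd.
have := (gP j).1; case: j jd => e /= ed; last by move=> /eqP ->; rewrite raddf0.
by apply: pihomog_ne0.
Qed.

Lemma face_ring_fg : exists gens : seq face_ring,
  forall m, exists a : nat -> S, m = \sum_(i < size gens) a i *: gens`_i.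
Proof.
exists [:: face_pi 1] => m; have [f ->] := face_piP m.
by exists (fun=> f); rewrite /= big_ord1 /= face_piZ mulr1.
Qed.

Definition face_ring_graded : gradedModule k n :=
  GradedModule face_comp_closed face_comp_scale face_comp_span
    face_comp_direct face_ring_fg.

End FaceRing.

Definition complex_sequentially_S (k : fieldType) (n : nat)
    (D : simplicialComplex n) (r : nat) : Prop :=
  sequentially_S (face_ring_graded k D) r.

Section Graph.
Variables (n : nat) (e : rel 'I_n).

Definition independent_sets : {set {set 'I_n}} :=
  [set F : {set 'I_n} | [forall x in F, forall y in F, ~~ e x y]].

Lemma independent_sets_closed (F G : {set 'I_n}) :
  G \in independent_sets -> F \subset G -> F \in independent_sets.
Proof.
rewrite !inE => /forall_inP GP /subsetP FG; apply/forall_inP => x xF.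
apply/forall_inP => y yF.
by have /forall_inP := GP x (FG x xF); apply; exact: FG.
Qed.

Definition independence_complex : simplicialComplex n :=
  SimplicialComplex independent_sets_closed.

Definition graph_sequentially_S (k : fieldType) (r : nat) : Prop :=
  complex_sequentially_S k independence_complex r.

(* c lists the vertices in cyclic order; the size condition is needed because
   cycle also accepts [:: x; y] when x and y are adjacent. *)
Definition chordless_cycle (c : seq 'I_n) : bool :=
  [&& (2 < size c)%N, ucycleb e c &
    all (fun x => all (fun y =>
      e x y ==> (y == next c x) || (x == next c y)) c) c].

End Graph.

(* Main.v *)
Require Import Defs.
(* mpoly comes first because it also defines symmetric. *)
From mathcomp Require Import mpoly.
From HB Require Import structures.
From mathcomp Require Import all_boot all_order all_algebra.
From mathcomp Require Import generic_quotient ring_quotient perm.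
From mathcomp Require Import ring zify.
From mathcomp Require Import boolp constructive_ereal.

(* Let m(s) be the largest size of a face containing the face s.  Filter the
   face ring by the classes supported on monomials x^a with m(supp a) below a
   threshold; the quotients are spanned by the monomials whose support lies in
   a layer { s | m(s) = d }, and have dimension d.

   Let p be a prime, T the set of variables outside p, and F run through the
   facets of size d containing T.  A quotient embeds in the product of the
   rings k[x_F], and an element of this product comes from the localization at
   p as soon as its components agree on intersections.  Hence y, z in p form a
   regular sequence if their restrictions to every k[x_F] do and if faces of
   size >= d containing T can be joined by faces on whose consecutive
   intersections y does not vanish.  Depending on |T| one takes for y, z the
   sum of the variables outside T, another symmetric polynomial in them, or
   polynomials in the variables of T given by unique factorization.  If
   |T| <= d - 2 the joining faces have to be found in the graph: given
   independent sets A, B of size >= d, the graph induced on their symmetric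
   difference is bipartite without chordless cycles, hence a forest, and a leaf
   v in A with neighbour b in B gives the independent set B - b + v, which meets
   both A and B outside their intersection. *)

Set Implicit Arguments.
Unset Strict Implicit.
Unset Printing Implicit Defensive.
Import Order.TTheory GRing.Theory Num.Theory Defs.

(** * Chordless cycles and independent sets *)

Section InducedCycle.
Variables (n : nat) (e : rel 'I_n).
Hypotheses (e_sym : symmetric e) (e_irr : irreflexive e).

(** Non-adjacency is tested only from earlier to later vertices; for a symmetric relation this
    describes an induced path. *)
Fixpoint induced_path (s : seq 'I_n) : bool :=
  if s is x :: s' then
    [&& x \notin s', (if s' is y :: t then e x y && all (fun z => ~~ e x z) t else true)
      & induced_path s']
  else true.

Lemma induced_path_uniq s : induced_path s -> uniq s.
Proof. by elim: s => //= x s IH /and3P[-> _ /IH]. Qed.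

Lemma induced_path_path x s : induced_path (x :: s) -> path e x s.
Proof.
elim: s x => // y s IH x /=.
by move=> /and3P[_ /andP[-> _] /IH].
Qed.

Lemma induced_path_adj x0 s i j : induced_path s -> (i < j < size s)%N ->
  e (nth x0 s i) (nth x0 s j) -> j = i.+1.
Proof.
elim: s i j => [|x s IH] [|i] [|j] //=; rewrite ?andbF //.
- case: s IH => [|y t] //= IH /and3P[_ /andP[_ /allP xt] _].
  case: j => //= j jt exj; suff: ~~ e x (nth x0 t j) by rewrite exj.
  exact/xt/mem_nth.
by move=> /and3P[_ _ si] /IH{}IH /IH->.
Qed.

Lemma induced_path_cat s1 s2 : induced_path (s1 ++ s2) -> induced_path s1.
Proof.
elim: s1 => //= x s1 IH /and3P[xs h /IH ->]; rewrite andbT.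
move: xs; rewrite mem_cat negb_or => /andP[-> _] /=.
by case: s1 h {IH} => //= y t /andP[->]; rewrite all_cat => /andP[].
Qed.

(** The path is induced and y is joined to its two ends only, so every edge of the closed walk links
    consecutive positions. *)
Lemma chordless_cycle_extend y x s z :
  induced_path (x :: rcons s z) -> y \notin x :: rcons s z ->
  e y x -> e y z -> all (fun u => ~~ e y u) s ->
  chordless_cycle e (y :: x :: rcons s z).
Proof.
move=> ip yn yx yz /allP ys; set c := y :: _.
have uc : uniq c by rewrite /= -/(uniq (x :: _)) induced_path_uniq // andbT.
have cE : size c = (size s).+3 by rewrite /c /= size_rcons.
apply/and3P; split; rewrite ?cE //.
  rewrite /ucycleb uc andbT /= rcons_path yx /= last_rcons e_sym yz andbT.
  exact: induced_path_path.
(* By symmetry of [e] only positions i < j matter. Position 0 is y; the others are those of the path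
   shifted by one. *)
have key i j : (i < j < size c)%N -> e (nth y c i) (nth y c j) ->
    (nth y c j == next c (nth y c i)) || (nth y c i == next c (nth y c j)).
  move=> /andP[ij jc]; have ic := ltn_trans ij jc.
  rewrite ![next _ _]next_nth !mem_nth // !index_uniq //.
  case: i ij ic => [|i] ij ic; last first.
    case: j ij jc => // j ij jc eij.
    have -> : j = i.+1 by apply: (induced_path_adj ip) eij; rewrite -ltnS ij.
    by rewrite /= eqxx.
  case: j ij jc => // -[|j] _ jc eyj; first by rewrite /= eqxx.
  apply/orP; right; move: eyj; rewrite /= in jc *.
  rewrite size_rcons !ltnS in jc; rewrite nth_rcons.
  case: ltngtP jc => // [js|->] _ eyj; last by rewrite nth_default ?size_rcons.
  by move: (ys _ (mem_nth y js)); rewrite eyj.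
apply/allP => u uc'; apply/allP => v vc'; apply/implyP => euv.
rewrite -(nth_index y uc') -(nth_index y vc') in euv *.
case: (ltngtP (index u c) (index v c)) => [lt|lt|eqi].
- by apply: key => //; rewrite lt index_mem.
- by rewrite orbC; apply: key; rewrite ?lt ?index_mem // e_sym.
- by move: euv; rewrite eqi e_irr.
Qed.

(* A longest induced path in U has an end with a second neighbour in U; the
   first chord of that neighbour back to the path closes an induced cycle. *)
Lemma chordless_cycle_exists (U : {set 'I_n}) x0 : x0 \in U ->
  (forall x, x \in U -> forall w, exists y, [/\ y \in U, e x y & y != w]) ->
  exists2 c, chordless_cycle e c & {subset c <= U}.
Proof.
move=> x0U deg2.
have [m [s [ss ip sU mmax]]] : exists m s, [/\ size s = m.+1, induced_path s,
    {subset s <= U} & forall s', induced_path s' -> {subset s' <= U} ->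
      (size s' <= m.+1)%N].
  pose P m := `[< exists s, [/\ size s = m, induced_path s & {subset s <= U}] >].
  have exP : exists m, P m.
    by exists 1; apply/asboolP; exists [:: x0]; split => // x; rewrite inE => /eqP->.
  have ubP m : P m -> (m <= n)%N.
    move=> /asboolP[s [<- /induced_path_uniq us _]].
    by rewrite -(card_uniqP us) -[X in (_ <= X)%N]card_ord max_card.
  case: (ex_maxnP exP ubP) => m /asboolP[s [sm ip sU]] mmax.
  have m0 : (0 < m)%N.
    by apply: mmax; apply/asboolP; exists [:: x0]; split => // x; rewrite inE => /eqP->.
  exists m.-1, s; rewrite prednK //; split => // s' ip' s'U.
  by apply: mmax; apply/asboolP; exists s'.
case: s => // x s in ss ip sU *.
(* The new neighbour avoids the successor of x on the path. If the path is just x, the default x of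
   [head] is harmless. *)
have [y [yU exy yw]] := deg2 x (sU x (mem_head _ _)) (head x s).
have yx : y != x by apply: contraTneq exy => ->; rewrite e_irr.
have ys : y \notin s.
  case: s ss ip sU yw => //= z s _ /and3P[_ /andP[_ /allP xs] _] _ yz.
  by rewrite inE negb_or yz; apply/negP => /xs; rewrite exy.
have yn : y \notin x :: s by rewrite inE negb_or yx.
(* If y had no neighbour in s, it would prolong the longest path. *)
have hs : has (e y) s.
  apply: contraT; rewrite -all_predC => /allP nys.
  have: (size (y :: x :: s) <= m.+1)%N.
    apply: mmax; last by move=> u; rewrite inE => /predU1P[->//|/sU].
    apply/and3P; split => //; rewrite e_sym exy /=; apply/allP => z zs.
    exact: nys.
  by rewrite -ss ltnn.
case: (split_find hs) ip sU yn => {ss ys hs yw} z s1 s2 eyz ns1 ip sU yn.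
have ip' : induced_path (x :: rcons s1 z).
  by apply: (@induced_path_cat _ s2); rewrite cat_cons.
exists (y :: x :: rcons s1 z).
  apply: chordless_cycle_extend => //; last by rewrite all_predC.
    by apply: contra yn; rewrite -cat_cons mem_cat => ->.
  by rewrite e_sym.
move=> u; rewrite inE => /predU1P[->//|us]; apply: sU.
by rewrite -cat_cons mem_cat us.
Qed.

(** Colours alternate along a walk, so a walk that returns to its start has an even number of
    steps. *)
Lemma bipartite_cycle_even (col : pred 'I_n) (c : seq 'I_n) :
  {in c &, forall x y, e x y -> col x != col y} -> cycle e c -> ~~ odd (size c).
Proof.
case: c => // x p colP /= pc.
have alt s u : {subset u :: s <= x :: p} -> path e u s ->
    col (last u s) = col u (+) odd (size s).
  elim: s u => [|v s IH] u sub /=; first by rewrite addbF.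
  move=> /andP[uv /IH ->]; last by move=> w ws; apply: sub; rewrite inE ws orbT.
  have := colP u v (sub u (mem_head _ _)) (sub v _) uv; rewrite !inE eqxx orbT => /(_ isT).
  by case: (col u); case: (col v); case: odd.
have sub : {subset x :: rcons p x <= x :: p}.
  by move=> u; rewrite -rcons_cons mem_rcons inE => /predU1P[->|//]; rewrite mem_head.
have := alt (rcons p x) x sub pc; rewrite last_rcons size_rcons /=.
by case: (col x); case: odd.
Qed.

Hypothesis no_even :
  ~ exists c : seq 'I_n, chordless_cycle e c /\ ~~ odd (size c).

Lemma independentP (A : {set 'I_n}) :
  reflect {in A &, forall x y, ~~ e x y} (A \in independent_sets e).
Proof.
rewrite inE; apply: (iffP forall_inP) => [AP x y xA yA|AP x xA].
  by have /forall_inP := AP x xA; apply.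
by apply/forall_inP => y yA; apply: AP.
Qed.

(* The graph induced on the symmetric difference of A and B is bipartite, so it
   is a forest, and has a leaf. *)
Lemma independent_leaf (A B : {set 'I_n}) :
  A \in independent_sets e -> B \in independent_sets e -> A :\: B != set0 ->
  exists v w, (v \in A :\: B /\ forall y, y \in B :\: A -> e v y -> y = w) \/
              (v \in B :\: A /\ forall y, y \in A :\: B -> e v y -> y = w).
Proof.
move=> /independentP Ai /independentP Bi /set0Pn[a aAB].
apply: contrapT => noleaf; apply: no_even.
pose U := (A :\: B) :|: (B :\: A).
have aU : a \in U by rewrite inE aAB.
have [|c cc cU] := chordless_cycle_exists aU.
  (* A vertex of U whose only possible neighbour in U is w would be a leaf. *)
  move=> x xU w; apply: contrapT => no; apply: noleaf; exists x, w.
  have nb y : y \in U -> e x y -> y = w.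
    by move=> yU exy; apply/eqP/negPn/negP => yw; apply: no; exists y.
  by case/setUP: xU => xU; [left|right]; split => // y yAB; apply: nb; rewrite inE yAB ?orbT.
(* Colour by membership in A: two vertices of U of equal colour lie both in A or both in B, and are
   not adjacent. *)
exists c; split => //; apply: (@bipartite_cycle_even (fun x => x \in A)); last first.
  by case/and3P: cc => _ /andP[].
move=> x y /cU xU /cU yU exy; apply/eqP => xyA.
case/setUP: xU => /setDP[xA xB].
  by move: (Ai x y xA); rewrite -xyA xA exy => /(_ isT).
case/setUP: yU => /setDP[yA yB]; first by rewrite xyA yA in xB.
by move: (Bi x y xA yA); rewrite exy.
Qed.

(** The set is C = B - b + v, where b is the only possible neighbour of v in B. It meets A in v, and
    it meets B outside A in a second element b' of B :\: A, which exists by the bound on the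
    intersection. *)
Lemma independent_exchange (A B : {set 'I_n}) (v w : 'I_n) :
  A \in independent_sets e -> B \in independent_sets e ->
  (#|A :&: B| + 2 <= #|B|)%N ->
  v \in A :\: B -> (forall y, y \in B :\: A -> e v y -> y = w) ->
  exists C, [/\ C \in independent_sets e, (#|B| <= #|C|)%N, A :&: B \subset C,
    A :&: B \proper A :&: C & A :&: B \proper C :&: B].
Proof.
move=> Ai Bi cB /setDP[vA vB] vw.
have cBA : (2 <= #|B :\: A|)%N.
  by rewrite -(leq_add2l #|B :&: A|) cardsID setIC.
(* If w is not in B :\: A, then v has no neighbour there and any b will do. *)
have [b bBA bw] : exists2 b, b \in B :\: A & forall y, y \in B :\: A -> e v y -> y = b.
  case: (boolP (w \in B :\: A)) => wBA; first by exists w.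
  have /card_gt0P[b bBA] : (0 < #|B :\: A|)%N by apply: leq_trans cBA.
  exists b => // y yBA evy; have yw := vw y yBA evy.
  by rewrite -yw yBA in wBA.
have [bB bA] := setDP bBA.
have vb : v \notin B :\ b by rewrite !inE (negPf vB) andbF.
have /card_gt0P[b' b'P] : (0 < #|(B :\: A) :\ b|)%N.
  by move: cBA; rewrite (cardsD1 b) bBA.
move: b'P; rewrite !inE => /and3P[b'b b'A b'B].
exists (v |: B :\ b).
have sub : A :&: B \subset v |: B :\ b.
  apply/subsetP => x /setIP[xA xB]; rewrite !inE xB andbT.
  by apply/orP; right; apply: contraNneq bA => <-.
split => //.
- have vn y : y \in B :\ b -> ~~ e v y.
    move=> /setD1P[yb yB]; apply/negP => evy.
    case: (boolP (y \in A)) => yA.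
      by move/independentP: Ai => /(_ v y vA yA); rewrite evy.
    by move: yb; rewrite (bw y) ?eqxx // inE yA.
  apply/independentP => x y /setU1P[->|xB] /setU1P[->|yB]; rewrite ?e_irr ?vn //.
    by rewrite e_sym vn.
  by move/independentP: Bi; apply; [case/setD1P: xB|case/setD1P: yB].
- by rewrite cardsU1 vb (cardsD1 b B) bB.
- apply/properP; split; first by rewrite subsetI subsetIl.
  by exists v; rewrite !inE ?vA ?eqxx ?(negPf vB).
- apply/properP; split; first by rewrite subsetI sub subsetIr.
  by exists b'; rewrite !inE ?b'B ?b'b ?orbT ?(negPf b'A).
Qed.

Lemma independent_connected d (A B : {set 'I_n}) :
  A \in independent_sets e -> B \in independent_sets e ->
  (d <= #|A|)%N -> (d <= #|B|)%N -> (#|A :&: B| + 2 <= d)%N ->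
  exists C, [/\ C \in independent_sets e, (d <= #|C|)%N, A :&: B \subset C,
    A :&: B \proper A :&: C & A :&: B \proper C :&: B].
Proof.
move=> Ai Bi dA dB dAB.
have AB0 : A :\: B != set0.
  rewrite -card_gt0 -(ltn_add2l #|A :&: B|) cardsID addn0.
  by apply: leq_trans dA; apply: leq_trans dAB; rewrite addn2.
have [v [w [[vAB vw]|[vBA vw]]]] := independent_leaf Ai Bi AB0.
  have [|C [Ci BC h1 h2 h3]] := independent_exchange Ai Bi _ vAB vw.
    exact: leq_trans dB.
  by exists C; split => //; apply: leq_trans BC.
have [|C [Ci BC h1 h2 h3]] := independent_exchange Bi Ai _ vBA vw.
  by rewrite setIC; apply: leq_trans dA.
rewrite setIC in h1 h2 h3; exists C; split => //; first exact: leq_trans BC.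
  by rewrite [A :&: C]setIC.
by rewrite [C :&: B]setIC.
Qed.

End InducedCycle.

(** * Unique factorization *)

Local Open Scope ring_scope.

Section Divides.
Variable A : idomainType.
Implicit Types (a b c x y : A) (s : seq A).

Definition divides a b := exists c, b = a * c.

Definition prime_elt a :=
  [/\ a != 0, a \isn't a GRing.unit &
      forall x y, divides a (x * y) -> divides a x \/ divides a y].

(** The factors are prime elements and not merely irreducible ones, so that uniqueness is automatic
    and [factorial_ring] describes unique factorization domains. *)
Definition has_factorization a := exists u s,
  [/\ u \is a GRing.unit, forall x, x \in s -> prime_elt x & a = u * \prod_(x <- s) x].

Definition factorial_ring := forall a, a != 0 -> has_factorization a.

Lemma has_factorizationM a b :
  has_factorization a -> has_factorization b -> has_factorization (a * b).
Proof.
move=> [u [s [uU sP ->]]] [v [t [vU tP ->]]]; exists (u * v), (s ++ t); split.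
- by rewrite unitrM uU.
- by move=> x; rewrite mem_cat => /orP[/sP|/tP].
by rewrite big_cat /=; ring.
Qed.

Lemma divides_unit a u : u \is a GRing.unit -> divides a u -> a \is a GRing.unit.
Proof. by move=> uU [c uE]; move: uU; rewrite uE unitrM => /andP[]. Qed.

(** The prime a divides one of the listed primes, is associate to it, and the two cancel. The drop
    in length is the induction measure in [content_split]. *)
Lemma cancel_prime_factor a b u s : prime_elt a -> u \is a GRing.unit ->
  (forall x, x \in s -> prime_elt x) -> a * b = u * \prod_(x <- s) x ->
  exists v t, [/\ v \is a GRing.unit, forall x, x \in t -> prime_elt x,
    (size t < size s)%N & b = v * \prod_(x <- t) x].
Proof.
move=> aP uU; have [a0 aU aM] := aP.
elim: s b => [|x s IH] b sP.
  rewrite big_nil mulr1 => abu; case/negP: aU.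
  by apply: (divides_unit uU); exists b.
have [x0 xU xM] := sP x (mem_head _ _).
have sP' y : y \in s -> prime_elt y by move=> ys; apply: sP; rewrite inE ys orbT.
rewrite big_cons mulrCA => abE.
(* If x = a c, then x divides a or c. In the first case c is a unit and x is cancelled; in the
   second a would be a unit. *)
have [|[c xE]|[c cE]] := aM x (u * \prod_(y <- s) y); first by exists b.
  have [|[e aE]|[e cE]] := xM a c; first by exists 1; rewrite -xE mulr1.
    have ec : e * c = 1.
      by apply: (mulfI x0); rewrite mulrA -aE -xE mulr1.
    exists (c * u), s; split => //.
      by rewrite unitrM uU andbT; apply/unitrP; exists e; rewrite ec mulrC ec.
    apply: (mulfI a0); rewrite abE {1}xE; ring.
  case/negP: aU; apply/unitrP; exists e.
  have ae : a * e = 1 by apply: (mulfI x0); rewrite mulr1 {2}xE cE; ring.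
  by rewrite mulrC ae.
have [v [t [vU tP lt ct]]] := IH c sP' (esym cE).
exists v, (x :: t); split => //=.
  by move=> y; rewrite inE => /predU1P[->|/tP].
by apply: (mulfI a0); rewrite abE cE ct big_cons; ring.
Qed.

End Divides.

(** * Gauss's lemma and factorization in a polynomial ring *)

Section Gauss.
Variable A : idomainType.
Hypothesis facA : factorial_ring A.
Implicit Types (a b c : A) (f g h p q : {poly A}).

Lemma dividesC c p : divides c%:P p <-> forall i, divides c p`_i.
Proof.
split=> [[q ->] i|dv]; first by exists q`_i; rewrite coefCM.
exists (\poly_(i < size p) projT1 (cid (dv i))); apply/polyP => i.
rewrite coefCM coef_poly; case: ltnP => ip; last by rewrite mulr0 nth_default.
by case: cid.
Qed.

Lemma unit_polyC c : (c%:P \is a GRing.unit) = (c \is a GRing.unit).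
Proof.
rewrite poly_unitE size_polyC coefC eqxx; case: (eqVneq c 0) => [->|] //=.
by rewrite unitr0.
Qed.

(** If c divides f g, it divides the product of the leading coefficients, hence one of them. The
    corresponding leading term is removed, and induction on the sizes applies. *)
Lemma prime_polyC c : prime_elt c -> prime_elt c%:P.
Proof.
move=> [c0 cU cM]; split; rewrite ?polyC_eq0 ?unit_polyC // => f g.
have [m] := ubnP (size f + size g); elim: m f g => // m IH f g lt dfg.
have [->|f0] := eqVneq f 0; first by left; exists 0; rewrite mulr0.
have [->|g0] := eqVneq g 0; first by right; exists 0; rewrite mulr0.
have tail p : p != 0 -> exists2 p', p = p' + (lead_coef p)%:P * 'X ^+ (size p).-1 &
    (size p' < size p)%N.
  move=> p0; exists (\poly_(i < (size p).-1) p`_i); last first.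
    by rewrite (leq_ltn_trans (size_poly _ _)) // prednK // size_poly_gt0.
  apply/polyP => i; rewrite coefD coef_poly coefCM coefXn.
  case: ltngtP => [lti|lti|->]; rewrite ?mulr0 ?addr0 ?mulr1 ?add0r //.
  by rewrite nth_default // -(prednK (n := size p)) // size_poly_gt0.
have [|dl|dl] := cM (lead_coef f) (lead_coef g).
- by rewrite -lead_coefM; exact: (dividesC c (f * g)).1.
- have [f' fE lt'] := tail f f0.
  have [||[f'' f'E]|] := IH f' g.
  + by rewrite -ltnS; apply: leq_trans lt; rewrite ltnS ltn_add2r.
  + case: dl dfg => w wE [v vE]; exists (v - w%:P * 'X ^+ (size f).-1 * g).
    by rewrite (canRL (addrK _) (esym fE)) wE [RHS]mulrBr -vE polyCM; ring.
  + left; case: dl => w wE; exists (f'' + w%:P * 'X ^+ (size f).-1).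
    by rewrite mulrDr -f'E mulrA -polyCM -wE.
  by right.
- have [g' gE lt'] := tail g g0.
  have [|||[g'' g'E]] := IH f g'.
  + by rewrite -ltnS; apply: leq_trans lt; rewrite ltnS ltn_add2l.
  + case: dl dfg => w wE [v vE]; exists (v - w%:P * 'X ^+ (size g).-1 * f).
    by rewrite (canRL (addrK _) (esym gE)) wE [RHS]mulrBr -vE polyCM; ring.
  + by left.
  right; case: dl => w wE; exists (g'' + w%:P * 'X ^+ (size g).-1).
  by rewrite mulrDr -g'E mulrA -polyCM -wE.
Qed.

Definition primitive_poly f := forall c, prime_elt c -> ~ divides c%:P f.

(** Each prime factor of c divides f w but not f, so it can be cancelled from w. *)
Lemma primitive_cancel f c h w : primitive_poly f -> c != 0 ->
  c%:P * h = f * w -> divides f h.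
Proof.
move=> fP /facA[u [s [uU sP ->]]].
elim: s w sP => [|x s IH] w sP.
  rewrite big_nil mulr1 => hE; exists (u^-1%:P * w).
  by rewrite mulrCA -hE mulrA -polyCM mulVr // mul1r.
have xP := sP x (mem_head _ _); rewrite big_cons => hE.
have [[x0 _ _]] := (xP).
have [_ _ xM] := prime_polyC xP.
have [|/(fP _ xP)//|[w' wE]] := xM f w.
  by exists ((u * \prod_(y <- s) y)%:P * h); rewrite -hE mulrCA polyCM; ring.
apply: (IH w'); first by move=> y ys; apply: sP; rewrite inE ys orbT.
have x0' : x%:P != 0 by rewrite polyC_eq0.
by apply: (mulfI x0'); rewrite mulrA -polyCM mulrCA hE wE; ring.
Qed.

(** This brings a factorization over the fraction field back to A: each prime factor of the
    denominator c divides g or w and is cancelled there, without change of degree. *)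
Lemma split_content f c g w : c != 0 -> c%:P * f = g * w ->
  exists g' w' e, [/\ f = g' * w', size g' = size g, size w' = size w &
    g = e%:P * g'].
Proof.
move=> /facA[u [s [uU sP ->]]].
elim: s g w sP => [|x s IH] g w sP.
  rewrite big_nil mulr1 => hE; exists g, (u^-1%:P * w), 1; split => //.
  - by rewrite mulrCA -hE mulrA -polyCM mulVr // mul1r.
  - by rewrite size_Cmul // invr_eq0; apply: contraTneq uU => ->; rewrite unitr0.
  by rewrite mul1r.
have xP := sP x (mem_head _ _); rewrite big_cons => hE.
have [[x0 _ _]] := (xP).
have x0' : x%:P != 0 by rewrite polyC_eq0.
have sP' y : y \in s -> prime_elt y by move=> ys; apply: sP; rewrite inE ys orbT.
have [_ _ xM] := prime_polyC xP.
have [|[g1 gE]|[w1 wE]] := xM g w.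
- by exists ((u * \prod_(y <- s) y)%:P * f); rewrite -hE mulrCA polyCM; ring.
- have [|g' [w' [e [fE sg sw ge]]]] := IH g1 w sP'.
    by apply: (mulfI x0'); rewrite mulrA -polyCM mulrCA hE gE; ring.
  exists g', w', (x * e); split => //; first by rewrite gE size_Cmul.
  by rewrite gE ge polyCM mulrA.
- have [|g' [w' [e [fE sg sw ge]]]] := IH g w1 sP'.
    by apply: (mulfI x0'); rewrite mulrA -polyCM mulrCA hE wE; ring.
  by exists g', w', e; split => //; rewrite wE size_Cmul.
Qed.

(** Divisibility by f is decided up to nonzero constants, as over the fraction field, by means of
    the gcd of f and g; [primitive_cancel] then removes the constants. *)
Lemma primitive_irreducible_prime f : primitive_poly f -> (1 < size f)%N ->
  (forall g w, f = g * w -> (size g <= 1)%N \/ (size w <= 1)%N) -> prime_elt f.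
Proof.
move=> fP sf firr; have f0 : f != 0 by rewrite -size_poly_gt0 ltnW.
split=> //.
  by rewrite poly_unitE; case: eqP sf => // ->.
move=> g h [v ghE]; have := leqP (size (gcdp f g)) 1; case=> sd.
  (* In the coprime case a Bezout relation multiplied by h exhibits a constant multiple of h as a
     multiple of f. *)
  right; have /Bezout_coprimepP[[u w] /= /eqpP[[c1 c2] /= /andP[c10 c20] E]] :
      coprimep f g.
    rewrite coprimep_def eqn_leq sd size_poly_gt0 gcdp_eq0 (negPf f0) //.
  rewrite alg_polyC in E; apply: (primitive_cancel fP c20 (w := c1%:P * (u * h + w * v))).
  rewrite -E -mul_polyC; transitivity (c1%:P * (u * f * h + w * (g * h))); first ring.
  by rewrite ghE; ring.
(* Otherwise the gcd is a nonconstant divisor of f up to constants. By irreducibility its cofactor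
   is constant, so f divides a constant multiple of g. *)
left; have /Pdiv.Idomain.dvdpP[[c q] /= c0] := dvdp_gcdl f g.
rewrite -mul_polyC mulrC [q * _]mulrC => cE.
have [|g' [w' [e [fE sg sw ge]]]] := split_content c0 (g := gcdp f g) (w := q) (f := f).
  by rewrite -cE mulrC.
have [|sw1] := firr _ _ fE; first by rewrite sg leqNgt sd.
have [c' w'E] : exists c', w' = c'%:P by exists w'`_0; exact: size1_polyC.
have c'0 : c' != 0.
  by apply: contraTneq sf => c'0; rewrite fE w'E c'0 mulr0 size_poly0.
have /Pdiv.Idomain.dvdpP[[b r] /= b0] := dvdp_gcdr f g.
rewrite -mul_polyC => bE.
apply: (primitive_cancel fP (mulf_neq0 c'0 b0) (w := r * e%:P)).
by rewrite polyCM -mulrA bE ge fE w'E; ring.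
Qed.

(** Prime constants are split off one at a time; each shortens a factorization of the leading
    coefficient. *)
Lemma content_split f : f != 0 -> exists c g,
  [/\ c != 0, f = c%:P * g & primitive_poly g].
Proof.
move=> f0; have [u [s [uU sP]]] : has_factorization (lead_coef f).
  by apply: facA; rewrite lead_coef_eq0.
have [m] := ubnP (size s).
elim: m f f0 u uU s sP => // m IH f f0 u uU s sP lt lE.
case: (pselect (primitive_poly f)) => [fP|].
  by exists 1, f; rewrite oner_neq0 mul1r.
move=> /existsNP[c /not_implyP[cP /contrapT[g fE]]].
have [c0 _ _] := cP.
have g0 : g != 0 by apply: contraNneq f0 => g0; rewrite fE g0 mulr0.
rewrite fE lead_coefM lead_coefC in lE.
have [v [t [vU tP ltt gl]]] := cancel_prime_factor cP uU sP lE.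
have [c' [g' [c'0 gE g'P]]] := IH g g0 v vU t tP (leq_trans ltt lt) gl.
exists (c * c'), g'; split => //; first exact: mulf_neq0.
by rewrite fE gE polyCM mulrA.
Qed.

(** The content factors in A. The primitive part is constant, or a product of two polynomials of
    smaller degree, or prime by [primitive_irreducible_prime]. *)
Lemma factorial_poly : factorial_ring {poly A}.
Proof.
have facC c : c != 0 -> has_factorization c%:P.
  move=> /facA[u [s [uU sP ->]]]; exists u%:P, (map polyC s).
  rewrite unit_polyC; split => //; first by move=> _ /mapP[x /sP/prime_polyC xP ->].
  by rewrite polyCM big_map rmorph_prod.
move=> f f0; have [m] := ubnP (size f); elim: m f f0 => // m IH f f0 lt.
have [c [g [c0 fE gP]]] := content_split f0.
have g0 : g != 0 by apply: contraNneq f0 => g0; rewrite fE g0 mulr0.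
have sfg : size f = size g by rewrite fE size_Cmul.
rewrite fE; apply: has_factorizationM; first exact: facC.
case: (leqP (size g) 1) => sg.
  by move: g0; rewrite (size1_polyC sg) polyC_eq0; exact: facC.
have [[p [q [gE sp sq]]]|no] :=
  pselect (exists p q, [/\ g = p * q, (1 < size p)%N & (1 < size q)%N]).
  have p0 : p != 0 by rewrite -size_poly_gt0 ltnW.
  have q0 : q != 0 by rewrite -size_poly_gt0 ltnW.
  have sgE : (size p + size q = (size g).+1)%N.
    by rewrite gE size_mul // prednK // addn_gt0 size_poly_gt0 p0.
  have szs : (size p < m)%N /\ (size q < m)%N by rewrite -sfg in sgE; lia.
  by rewrite gE; case: szs => pm qm; apply: has_factorizationM; apply: IH.
exists 1, [:: g]; split; rewrite ?unitr1 // ?big_seq1 ?mul1r //.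
move=> x; rewrite inE => /eqP->; apply: primitive_irreducible_prime => // p q gE.
have [sp|sp] := leqP (size p) 1; first by left.
have [sq|sq] := leqP (size q) 1; first by right.
by case: no; exists p, q.
Qed.

End Gauss.

Lemma factorial_iso (A B : idomainType) (f : {rmorphism A -> B}) (g : {rmorphism B -> A}) :
  cancel f g -> cancel g f -> factorial_ring B -> factorial_ring A.
Proof.
move=> fK gK facB a a0; have [|u [s [uU sP faE]]] := facB (f a).
  by rewrite -(rmorph0 f) (can_eq fK).
exists (g u), (map g s); split; first exact: rmorph_unit.
  move=> _ /mapP[x /sP[x0 xU xM] ->]; split.
  - by rewrite -(rmorph0 g) (can_eq gK).
  - by apply: contra xU => /(rmorph_unit f); rewrite gK.
  move=> y z [c yzE]; have [|[d dE]|[d dE]] := xM (f y) (f z).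
  - by exists (f c); rewrite -rmorphM yzE rmorphM gK.
  - by left; exists (g d); rewrite -rmorphM -dE fK.
  - by right; exists (g d); rewrite -rmorphM -dE fK.
by rewrite -[LHS]fK faE rmorphM rmorph_prod big_map.
Qed.

(** * Polynomial rings in several variables over a field *)

Section MpolyFactorial.
Variable k : fieldType.

Lemma mpoly_morph_ext n (R : nzRingType) (f g : {rmorphism {mpoly k[n]} -> R}) :
  (forall c, f c%:MP = g c%:MP) -> (forall i, f 'X_i = g 'X_i) -> f =1 g.
Proof.
move=> fgC fgX p; rewrite [p]mpolyE !rmorph_sum; apply: eq_bigr => m _ /=.
rewrite -mul_mpolyC !rmorphM fgC mpolyXE_id !rmorph_prod; congr (_ * _).
by apply: eq_bigr => i _; rewrite !rmorphXn /= fgX.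
Qed.

Section Step.
Variable n : nat.

(** Singles out the variable of index [ord0] as the outer variable; [of_poly] is the inverse
    isomorphism. *)
Definition to_poly : {mpoly k[n.+1]} -> {poly {mpoly k[n]}} :=
  mmap (polyC \o mpolyC n (R := k))
       (fun i => if unlift ord0 i is Some j then ('X_j)%:P else 'X).

HB.instance Definition _ := GRing.RMorphism.on to_poly.

Definition lift_mpoly : {mpoly k[n]} -> {mpoly k[n.+1]} :=
  mmap (mpolyC n.+1 (R := k)) (fun i => 'X_(lift ord0 i)).

HB.instance Definition _ := GRing.RMorphism.on lift_mpoly.

Definition of_poly (p : {poly {mpoly k[n]}}) : {mpoly k[n.+1]} :=
  (map_poly lift_mpoly p).['X_ord0].

Lemma of_poly_zmod : zmod_morphism of_poly.
Proof. by move=> p q; rewrite /of_poly rmorphB hornerD hornerN. Qed.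
Lemma of_poly_monoid : monoid_morphism of_poly.
Proof. by split=> [|p q]; rewrite /of_poly ?rmorph1 ?hornerC // rmorphM hornerM. Qed.
HB.instance Definition _ := GRing.isZmodMorphism.Build _ _ of_poly of_poly_zmod.
HB.instance Definition _ := GRing.isMonoidMorphism.Build _ _ of_poly of_poly_monoid.

Lemma to_polyK : cancel to_poly of_poly.
Proof.
apply: (mpoly_morph_ext (f := of_poly \o to_poly) (g := idfun)) => [c|i] /=.
  by rewrite /to_poly mmapC /= /of_poly map_polyC hornerC /= /lift_mpoly mmapC.
rewrite /to_poly mmapX mmap1U /of_poly; case: unliftP => [j|] ->.
  by rewrite map_polyC hornerC /= /lift_mpoly mmapX mmap1U.
by rewrite map_polyX hornerX.
Qed.

Lemma to_poly_lift p : to_poly (lift_mpoly p) = p%:P.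
Proof.
apply: (mpoly_morph_ext (f := to_poly \o lift_mpoly) (g := polyC)) => [c|i] /=.
  by rewrite /lift_mpoly mmapC /to_poly mmapC.
by rewrite /lift_mpoly mmapX mmap1U /to_poly mmapX mmap1U liftK.
Qed.

Lemma of_polyK : cancel of_poly to_poly.
Proof.
move=> p; rewrite -[p]coefK poly_def !rmorph_sum; apply: eq_bigr => i _ /=.
rewrite -mul_polyC !rmorphM !rmorphXn; congr (_ * _ ^+ _).
  by rewrite /= /of_poly map_polyC hornerC /= to_poly_lift.
rewrite /= /of_poly map_polyX hornerX /to_poly mmapX mmap1U.
by case: unliftP => // j /eqP; rewrite (negPf (neq_lift _ _)).
Qed.

End Step.

Lemma factorial_mpoly n : factorial_ring {mpoly k[n]}.
Proof.
elim: n => [|n /factorial_poly]; last first.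
  exact: factorial_iso (@to_polyK n) (@of_polyK n).
move=> a a0; exists a, [::]; split=> //; last by rewrite big_nil mulr1.
have c0 : a@_0 != 0 by apply: contraNneq a0 => c0; rewrite -[a]mpolyKC c0 mpolyC0.
apply/unitrP; exists (a@_0)^-1%:MP; rewrite -{2 3}[a]mpolyKC -!mpolyCM.
by rewrite mulVf // mulfV.
Qed.

End MpolyFactorial.

(** * Primes of polynomial rings *)

Section Restriction.
Variables (k : fieldType) (n : nat).
Local Notation S := {mpoly k[n]}.
Implicit Types (f g h : S) (m : 'X_{1..n}) (F G : {set 'I_n}).

Definition mset m : {set 'I_n} := [set i | m i != 0%N].

Lemma msetD m1 m2 : mset (m1 + m2)%MM = mset m1 :|: mset m2.
Proof. by apply/setP => i; rewrite !inE mnmDE addn_eq0 negb_and. Qed.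

Definition subst (s : 'I_n -> S) : S -> S := mmap (@mpolyC n k) s.

HB.instance Definition _ s := GRing.RMorphism.on (subst s).

Lemma substC s c : subst s c%:MP = c%:MP.
Proof. exact: mmapC. Qed.

Lemma substX s i : subst s 'X_i = s i.
Proof. by rewrite /subst mmapX mmap1U. Qed.

Lemma substXm s m : subst s 'X_[m] = \prod_i s i ^+ m i.
Proof. by rewrite /subst mmapX. Qed.

(** The retraction onto k[x_F]. Throughout, [restr F f = f] expresses that f involves only variables
    of F. *)
Definition restr F : S -> S := subst (fun i => if i \in F then 'X_i else 0).

HB.instance Definition _ F := GRing.RMorphism.on (restr F).

Lemma restrX F i : restr F 'X_i = if i \in F then 'X_i else 0.
Proof. exact: substX. Qed.

Lemma restrXm F m : restr F 'X_[m] = if mset m \subset F then 'X_[m] else 0.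
Proof.
rewrite /restr substXm; case: ifPn => [/subsetP mF|/subsetPn[i]].
  rewrite mpolyXE_id; apply: eq_bigr => i _; case: ifPn => // iF.
  case: (eqVneq (m i) 0%N) => [->|mi]; first by rewrite !expr0.
  by case/negP: iF; apply: mF; rewrite inE.
rewrite inE => mi iF; rewrite (bigD1 i) //= (negPf iF) expr0n (negPf mi).
by rewrite mul0r.
Qed.

Lemma mcoeff_restr F f m : (restr F f)@_m = if mset m \subset F then f@_m else 0.
Proof.
rewrite {1}[f]mpolyE rmorph_sum raddf_sum /=.
rewrite [X in if _ then X else _](_ : _ = \sum_(m' <- msupp f) (f@_m' *: 'X_[m'])@_m); last first.
  by rewrite {1}[f]mpolyE raddf_sum.
transitivity (\sum_(m' <- msupp f) if mset m \subset F then (f@_m' *: 'X_[m'])@_m else 0).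
  apply: eq_bigr => m' _; rewrite -mul_mpolyC rmorphM /= /restr substC -/(restr _).
  rewrite restrXm !mcoeffCM.
  case: (eqVneq m' m) => [->|m'm]; first by case: ifP; rewrite // mcoeff0 mulr0.
  by case: ifP; rewrite !mcoeffX (negPf m'm) ?mcoeff0 mulr0; case: ifP.
by case: ifP => // _; rewrite big1.
Qed.

Lemma restr_restr F G f : restr F (restr G f) = restr (F :&: G) f.
Proof.
by apply/mpolyP => m; rewrite !mcoeff_restr subsetI; case: (_ \subset F).
Qed.

Lemma restr_id F G f : F \subset G -> restr F (restr G f) = restr F f.
Proof. by move=> /setIidPl FG; rewrite restr_restr FG. Qed.

Lemma restr_sub F G f : F \subset G -> restr G (restr F f) = restr F f.
Proof. by move=> /setIidPr FG; rewrite restr_restr FG. Qed.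

Lemma mpoly_ring_ind (P : S -> Prop) : (forall c, P c%:MP) -> (forall i, P 'X_i) ->
  (forall f g, P f -> P g -> P (f + g)) -> (forall f g, P f -> P g -> P (f * g)) ->
  forall f, P f.
Proof.
move=> PC PX PD PM f; rewrite [f]mpolyE; elim/big_ind: _ => [||m _]; [|exact: PD|].
  by rewrite -mpolyC0; apply: PC.
rewrite -mul_mpolyC; apply: (PM) => //; rewrite mpolyXE_id.
elim/big_ind: _ => [||i _]; [by rewrite -mpolyC1; apply: PC|exact: PM|].
by elim: (m i) => [|e IH]; rewrite ?expr0 -?mpolyC1 // exprS; apply: (PM).
Qed.

(** The polynomials that agree with their substitution modulo the ideal I form a subring containing
    the constants and the variables. *)
Lemma subst_ideal (I : S -> Prop) s f :
  I 0 -> (forall a b, I a -> I b -> I (a + b)) -> (forall a b, I b -> I (a * b)) ->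
  (forall i, I ('X_i - s i)) -> I (f - subst s f).
Proof.
move=> I0 ID IM Is; elim/mpoly_ring_ind: f => [c|i|f g If Ig|f g If Ig].
- by rewrite substC subrr.
- by rewrite substX.
- by rewrite rmorphD /= opprD addrACA; apply: ID.
rewrite rmorphM /= (_ : _ - _ = f * (g - subst s g) + subst s g * (f - subst s f)).
  by apply: ID; apply: IM.
by ring.
Qed.

(** Used to read off divisibility: what a substitution of the i-th variable alone sends to 0 is a
    multiple of 'X_i - s i. *)
Lemma subst_divides s i f : (forall j, j != i -> s j = 'X_j) ->
  divides ('X_i - s i) (f - subst s f).
Proof.
move=> sj; apply: (subst_ideal (I := divides ('X_i - s i))) => [|a b [c ->] [d ->]|a b [c ->]|j].
- by exists 0; rewrite mulr0.
- by exists (c + d); rewrite mulrDr.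
- by exists (a * c); rewrite mulrCA.
by case: (eqVneq j i) => [->|/sj ->]; [exists 1; rewrite mulr1|exists 0; rewrite subrr mulr0].
Qed.

End Restriction.

(** * Prime ideals as predicates *)

Section Primes.

Record is_prime (R : comNzRingType) (q : R -> Prop) : Prop := IsPrime {
  prime0 : q 0;
  primeD : forall a b, q a -> q b -> q (a + b);
  primeMl : forall a b, q b -> q (a * b);
  prime1 : ~ q 1;
  primeM : forall a b, q (a * b) -> q a \/ q b }.

Lemma prime_idealr_is_prime (R : comNzRingType) (p : prime_idealr R) :
  is_prime (fun a => a \in p).
Proof.
split; first exact: rpred0.
- exact: rpredD.
- exact: idealMr.
- by rewrite idealr1.
by move=> a b; rewrite prime_idealrM => /orP.
Qed.

Variables (R : comNzRingType) (q : R -> Prop).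
Hypothesis qP : is_prime q.

Lemma primeMr a b : q a -> q (a * b).
Proof. by rewrite mulrC; apply: primeMl. Qed.

Lemma primeN a : q a -> q (- a).
Proof. by rewrite -mulN1r; apply: primeMl. Qed.

Lemma primeB a b : q a -> q b -> q (a - b).
Proof. by move=> qa /primeN; apply: primeD. Qed.

Lemma primeBE a b : q (a - b) -> q a <-> q b.
Proof.
move=> qab; split=> h; last by rewrite -(subrK b a); apply: primeD.
by rewrite -(subKr a b); apply: primeB.
Qed.

Lemma prime_prod (I : finType) (P : pred I) (F : I -> R) :
  q (\prod_(i | P i) F i) -> exists2 i, P i & q (F i).
Proof.
move=> h; apply: contrapT => no; move: h.
elim/big_ind: _ => [/(prime1 qP)//|a b ha hb /(primeM qP)[]//|i Pi qi].
by apply: no; exists i.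
Qed.

Lemma prime_sum (I : Type) (r : seq I) (P : pred I) (F : I -> R) :
  (forall i, P i -> q (F i)) -> q (\sum_(i <- r | P i) F i).
Proof. by move=> h; elim/big_ind: _ => //; [exact: prime0|exact: primeD]. Qed.

End Primes.

Lemma prime_unit (R : comUnitRingType) (q : R -> Prop) u :
  is_prime q -> u \is a GRing.unit -> ~ q u.
Proof.
by move=> qP uU qu; apply: (prime1 qP); rewrite -(mulVr uU); apply: primeMl.
Qed.

Section RestrictionPrime.
Variables (k : fieldType) (n : nat) (q : {mpoly k[n]} -> Prop) (F : {set 'I_n}).
Hypotheses (qP : is_prime q) (qF : forall i, i \notin F -> q 'X_i).

(** Thus a prime that contains the variables outside F is determined by its trace on k[x_F]. *)
Lemma prime_restrB f : q (f - restr F f).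
Proof.
apply: (subst_ideal (I := q)) => [|||i]; [exact: prime0|exact: primeD|exact: primeMl|].
by case: ifPn => [_|/qF]; rewrite ?subrr ?subr0 //; exact: prime0.
Qed.

Lemma prime_restr f : q (restr F f) <-> q f.
Proof. by apply: iff_sym; apply: primeBE (prime_restrB f). Qed.

End RestrictionPrime.

(** * Algebraic independence along chains of primes *)

Section KrullBound.
Variables (k : fieldType) (A : comNzRingType) (emb : {rmorphism k -> A}).

Definition eval r (z : 'I_r -> A) : {mpoly k[r]} -> A := mmap emb z.

HB.instance Definition _ r (z : 'I_r -> A) := GRing.RMorphism.on (eval z).

Lemma eval_to_poly r (z : 'I_r.+1 -> A) P :
  eval z P = (map_poly (eval (fun i => z (lift ord0 i))) (to_poly P)).[z ord0].
Proof.
have zm : zmod_morphism (fun p : {poly {mpoly k[r]}} =>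
    (map_poly (eval (fun i => z (lift ord0 i))) p).[z ord0]).
  by move=> p q; rewrite rmorphB hornerD hornerN.
have mm : monoid_morphism (fun p : {poly {mpoly k[r]}} =>
    (map_poly (eval (fun i => z (lift ord0 i))) p).[z ord0]).
  by split=> [|p q]; rewrite ?rmorph1 ?hornerC // rmorphM hornerM.
pose g : {rmorphism {poly {mpoly k[r]}} -> A} :=
  HB.pack (fun p => (map_poly (eval (fun i => z (lift ord0 i))) p).[z ord0])
   (GRing.isZmodMorphism.Build _ _ _ zm) (GRing.isMonoidMorphism.Build _ _ _ mm).
apply: (mpoly_morph_ext (f := eval z) (g := g \o @to_poly k r)) => [c|i] /=.
  by rewrite /eval mmapC /to_poly mmapC /= map_polyC hornerC /= mmapC.
rewrite /to_poly /eval !mmapX !mmap1U; case: unliftP => [j|] ->.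
  by rewrite map_polyC hornerC /= mmapX mmap1U.
by rewrite map_polyX hornerX.
Qed.

(* Coquand and Lombardi: along a chain of primes, a polynomial relation between
   the z i is peeled off variable by variable, keeping the terms of lowest
   degree, until it becomes a nonzero constant. *)
Lemma prime_chain_independent r (q : nat -> A -> Prop) (z : 'I_r -> A) :
  (forall i, (i <= r)%N -> is_prime (q i)) ->
  (forall i a, (i < r)%N -> q i a -> q i.+1 a) ->
  (forall i : 'I_r, q i.+1 (z i) /\ ~ q i (z i)) ->
  forall P, P != 0 -> ~ q 0%N (eval z P).
Proof.
elim: r q z => [|r IH] q z qP qS zq P P0.
  (* Without variables P is a nonzero constant, which lies in no prime. *)
  have c0 : P@_0 != 0 by apply: contraNneq P0 => c0; rewrite -[P]mpolyKC c0 mpolyC0.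
  rewrite -[P]mpolyKC /eval mmapC => qc; apply: (prime1 (qP 0%N isT)).
  rewrite -(rmorph1 emb) -(mulVf c0) rmorphM; apply: primeMl => //; exact: qP.
rewrite eval_to_poly; set ev := eval _; set p := to_poly P.
have : p != 0 by rewrite -(rmorph0 (@to_poly k r)) (can_eq (@to_polyK k r)).
have q0 := qP 0%N isT; have q1 := qP 1%N isT; have [z1 z0] := zq ord0.
(* If the constant coefficient in the first variable is 0, that variable is factored out, its value
   not being in q 0. Otherwise one passes to q 1, which contains the value, and only the constant
   coefficient remains. *)
elim/poly_ind: p => [|p c IHp]; first by rewrite eqxx.
have [-> pX0|c0 _] := eqVneq c 0.
  rewrite addr0 rmorphM /= map_polyX hornerM hornerX => /(primeM q0)[]//.
  by apply: IHp; apply: contraNneq pX0 => ->; rewrite mul0r addr0.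
rewrite rmorphD rmorphM /= map_polyX map_polyC hornerD hornerM hornerX hornerC /=.
move=> /(qS 0%N _ isT) h.
apply: (IH (fun i => q i.+1) (fun i => z (lift ord0 i)) _ _ _ _ c0).
- by move=> i ir; apply: qP.
- by move=> i a ir; apply: qS.
- by move=> i; have := zq (lift ord0 i); rewrite lift0.
rewrite -/ev; move: h; set t := _ * z ord0 => h.
have -> : ev c = t + ev c - t by rewrite addrAC subrr add0r.
by apply: primeB => //; apply: primeMl.
Qed.

End KrullBound.

Lemma mcoeffM_neq0 (k : fieldType) n (f g : {mpoly k[n]}) m : (f * g)@_m != 0 ->
  exists m1 m2, [/\ m = (m1 + m2)%MM, f@_m1 != 0 & g@_m2 != 0].
Proof.
rewrite -mcoeff_msupp => /msuppM_le/allpairsP[[m1 m2] /= [h1 h2 ->]].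
by exists m1, m2; rewrite -!mcoeff_msupp.
Qed.

(** * Algebraic dependence and the length of prime chains *)

Section AlgebraicDependence.
Variables (k : fieldType) (n : nat).
Local Notation S := {mpoly k[n]}.

Definition deg_le (f : S) c := forall m, f@_m != 0 -> (mdeg m <= c)%N.

Lemma deg_le_exists f : exists c, deg_le f c.
Proof. by exists (msize f) => m; rewrite -mcoeff_msupp => /msize_mdeg_lt/ltnW. Qed.

Lemma deg_leM f g a b : deg_le f a -> deg_le g b -> deg_le (f * g) (a + b)%N.
Proof.
move=> fa gb m /mcoeffM_neq0[m1 [m2 [-> /fa h1 /gb h2]]].
by rewrite mdegD leq_add.
Qed.

Lemma deg_le1 : deg_le 1 0.
Proof. by move=> m; rewrite mcoeff1; case: (eqVneq m 0%MM) => [->|_]; rewrite ?mdeg0 ?eqxx. Qed.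

Lemma dependent_rows (I J : finType) (c : I -> J -> k) : (#|J| < #|I|)%N ->
  exists v : I -> k, (exists i, v i != 0) /\ forall j, \sum_i v i * c i j = 0.
Proof.
move=> JI; pose M := \matrix_(i < #|I|, j < #|J|) c (enum_val i) (enum_val j).
have : kermx M != 0.
  by rewrite kermx_eq0 -row_leq_rank -ltnNge (leq_ltn_trans (rank_leq_col M)).
move=> /rowV0Pn[v /sub_kermxP vM v0].
exists (fun i => v ord0 (enum_rank i)); split.
  by have /rV0Pn[i vi] := v0; exists (enum_val i); rewrite enum_valK.
move=> j; have /matrixP/(_ ord0 (enum_rank j)) := vM; rewrite !mxE => vMj.
rewrite -[RHS]vMj (reindex_onto enum_val enum_rank) /=; last by move=> i _; rewrite enum_rankK.
by apply: eq_big => [i|i _]; rewrite ?enum_valK ?eqxx // !mxE enum_rankK.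
Qed.

(** By counting: there are more products of the z i with bounded exponents than monomials in the
    variables of F that can occur in them, so some nontrivial combination vanishes. *)
Lemma algebraic_dependence (F : {set 'I_n}) (z : 'I_#|F|.+1 -> S) :
  (forall i, restr F (z i) = z i) ->
  exists P, P != 0 /\ eval (@mpolyC n k) z P = 0.
Proof.
move=> zF; set d := #|F|.
have [C zC] : exists C, forall i, deg_le (z i) C.
  have /choice[c cP] : forall i, exists c, deg_le (z i) c by move=> i; exact: deg_le_exists.
  exists (\max_i c i) => i m /cP /leq_trans; apply; exact: leq_bigmax.
(* Products with exponents below t have degree at most (d+1) t C < B, so at most B^d = t^d K^d
   monomials occur; as t > K^d, this is less than t^(d+1). *)
pose K := (d.+1 * C).+1; pose t := (K ^ d).+1; pose B := (t * K)%N.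
pose E : finType := {ffun 'I_d.+1 -> 'I_t}.
pose J : finType := {ffun {x | x \in F} -> 'I_B}.
pose mE (e : E) := [multinom (e i : nat) | i < d.+1].
pose zE (e : E) := \prod_i z i ^+ e i.
pose mJ (g : J) := [multinom (if insub i is Some u then g u : nat else 0%N) | i < n].
have JE : (#|J| < #|E|)%N.
  rewrite !card_ffun !card_ord card_sig -/d expnMn expnS mulnC ltn_pmul2r //.
  by rewrite expn_gt0.
have [v [[e0 ve0] vP]] := dependent_rows (fun e g => (zE e)@_(mJ g)) JE.
exists (\sum_e v e *: 'X_[mE e]); split.
  apply/eqP => /(congr1 (mcoeff (mE e0))); rewrite mcoeff0 raddf_sum /=.
  rewrite (bigD1 e0) //= mcoeffZ mcoeffX eqxx mulr1 big1 ?addr0; first exact/eqP.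
  move=> e ee0; rewrite mcoeffZ mcoeffX; case: eqP => [/mnmP eE|]; last by rewrite mulr0.
  case/eqP: ee0; apply/ffunP => i; apply: val_inj.
  by have := eE i; rewrite !mnmE.
have zEE e : zE e = eval (@mpolyC n k) z 'X_[mE e].
  by rewrite /eval mmapX /mmap1; apply: eq_bigr => i _; rewrite mnmE.
rewrite rmorph_sum /=; apply/mpolyP => m; rewrite mcoeff0 raddf_sum /=.
under eq_bigr => e _ do rewrite -mul_mpolyC rmorphM /= {1}/eval mmapC -zEE mcoeffCM.
have zEF e : restr F (zE e) = zE e.
  rewrite /zE rmorph_prod; apply: eq_bigr => i _ /=; by rewrite rmorphXn /= zF.
have zED e : deg_le (zE e) (d.+1 * (t * C)).
  have -> : (d.+1 * (t * C) = \sum_(i < d.+1) t * C)%N by rewrite sum_nat_const card_ord.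
  rewrite /zE; elim/big_rec2: _ => [|i a f _ fa]; first exact: deg_le1.
  apply: deg_leM => // m' h.
  apply: leq_trans (_ : (e i * C <= _)%N); last by rewrite leq_mul2r ltnW ?orbT.
  move: m' h; change (deg_le (z i ^+ e i) (e i * C)%N).
  elim: (nat_of_ord (e i)) => [|j IH]; first exact: deg_le1.
  by rewrite exprS mulSn; apply: deg_leM.
case: (pselect ((mset m \subset F) /\ (mdeg m <= d.+1 * (t * C))%N)) => [[mF mD]|no].
  have mB i : (m i < B)%N.
    apply: leq_ltn_trans (_ : m i <= mdeg m)%N _.
      by rewrite mdegE (bigD1 i) //= leq_addr.
    by apply: leq_ltn_trans mD _; rewrite /B /K mulnCA mulnS -addn1 addnC leq_add2r.
  pose g : J := [ffun u => Ordinal (mB (val u))].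
  have -> : m = mJ g; last exact: vP.
  apply/mnmP => i; rewrite mnmE; case: insubP => [u _ ui|iF]; first by rewrite ffunE /= ui.
  apply/eqP/negPn; apply: contra iF => mi; apply: (subsetP mF).
  by rewrite inE.
rewrite big1 // => e _; rewrite [X in _ * X](_ : _ = 0) ?mulr0 //.
apply/eqP/negPn/negP => h; apply: no; split; last exact: zED h.
by move: h; rewrite -zEF mcoeff_restr; case: ifP => //; rewrite eqxx.
Qed.

(** Elements separating consecutive primes may be restricted to F. A longer chain would give |F|+1
    of them, algebraically independent by [prime_chain_independent], against
    [algebraic_dependence]. *)
Lemma prime_chain_bound (q : nat -> S -> Prop) r (F : {set 'I_n}) :
  (forall i, (i <= r)%N -> is_prime (q i)) ->
  (forall i a, (i < r)%N -> q i a -> q i.+1 a) ->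
  (forall i, (i < r)%N -> exists a, q i.+1 a /\ ~ q i a) ->
  (forall j, j \notin F -> q 0%N 'X_j) -> (r <= #|F|)%N.
Proof.
move=> qP qS qN qF; rewrite leqNgt; apply/negP => Fr.
have qF' i : (i <= r)%N -> forall j, j \notin F -> q i 'X_j.
  by elim: i => [|i IH] ir j jF; [exact: qF|apply: qS => //; apply: IH => //; apply: ltnW].
have /choice[z zP] : forall i : 'I_#|F|.+1, exists a, restr F a = a /\ (q i.+1 a /\ ~ q i a).
  move=> i; have ir : (i < r)%N by apply: leq_trans Fr; exact: ltn_ord.
  have [a [a1 a0]] := qN i ir; exists (restr F a); split; first exact: restr_sub.
  have qi := qP i (ltnW ir); have qi1 := qP i.+1 ir.
  split; first by apply/(prime_restr qi1) => //; apply: qF'.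
  by move=> /(prime_restr qi (qF' i (ltnW ir))).
have [P [P0 Pz]] := algebraic_dependence (fun i => (zP i).1).
apply: (@prime_chain_independent k _ (@mpolyC n k) _ q z _ _ _ P P0).
- by move=> i iF; apply: qP; apply: leq_trans iF _.
- by move=> i a iF; apply: qS; apply: leq_trans iF _.
- by move=> i; exact: (zP i).2.
by rewrite Pz; apply: prime0; exact: qP.
Qed.

End AlgebraicDependence.

(** * Depth of localizations *)

Section NatSup.
Variable P : nat -> Prop.

Lemma nat_sup_ge d : P d -> ((d%:Z)%:E <= nat_sup P)%E.
Proof.
move=> Pd; rewrite /nat_sup; case: pselect => [maxP|_].
  by case: cid => m /= [Pm mP]; rewrite lee_fin lez_nat; apply: mP.
by rewrite ifT ?leey //; apply/asboolP; exists d.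
Qed.

Lemma nat_sup_le c : (forall d, P d -> (d <= c)%N) -> (nat_sup P <= (c%:Z)%:E)%E.
Proof.
move=> Pc; rewrite /nat_sup; case: pselect => [maxP|no].
  by case: cid => m /= [Pm mP]; rewrite lee_fin lez_nat; apply: Pc.
case: asboolP => [[d Pd]|_]; last exact: leNye.
case: no; pose Q m := `[< P m >]; have exQ : exists m, Q m by exists d; apply/asboolP.
have ubQ m : Q m -> (m <= c)%N by move=> /asboolP/Pc.
case: (ex_maxnP exQ ubQ) => m /asboolP Pm mP; exists m; split => // m' Pm'.
by apply: mP; apply/asboolP.
Qed.

Lemma nat_sup_lt0 : (forall d, ~ P d) -> nat_sup P = -oo%E.
Proof.
move=> no; rewrite /nat_sup; case: pselect => [[d [/no]]//|_].
by case: asboolP => // -[d /no].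
Qed.

End NatSup.

(** * Nakayama's lemma at a prime *)

Section Nakayama.
Variables (R : comNzRingType) (M : lmodType R) (q : R -> Prop).
Hypothesis qP : is_prime q.

Lemma prime_det_congr r (A B : 'M[R]_r) :
  (forall i j, q (A i j - B i j)) -> q (\det A - \det B).
Proof.
move=> AB; rewrite /determinant -sumrB; apply: (prime_sum qP) => s _.
rewrite -mulrBr; apply: (primeMl qP).
elim/big_rec2: _ => [|i x y _ xy]; first by rewrite subrr; apply: prime0.
rewrite (_ : _ - _ = A i (s i) * (y - x) + (A i (s i) - B i (s i)) * x); last by ring.
by apply: (primeD qP); [exact: primeMl|exact: primeMr].
Qed.

(** The determinant trick: the relations form a matrix whose determinant kills M, and modulo q it is
    the product of the denominators s i, which is not in q. *)
Lemma nakayama (gens : seq M) :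
  (forall m, exists a : nat -> R, m = \sum_(i < size gens) a i *: gens`_i) ->
  (forall m, exists s, ~ q s /\ exists a : nat -> R, (forall i, q (a i)) /\
     s *: m = \sum_(i < size gens) a i *: gens`_i) ->
  exists s, ~ q s /\ forall m : M, s *: m = 0.
Proof.
move=> span h; set r := size gens in span h *.
have /choice[s sP] := fun i : 'I_r => h gens`_i.
have /choice[a aP] := fun i => (sP i).2.
pose B : 'M[R]_r := diag_mx (\row_i s i).
pose A : 'M[R]_r := B - \matrix_(i, j) a i j.
have Ag i : \sum_j A i j *: gens`_j = 0.
  rewrite (eq_bigr (fun j : 'I_r => (B i j *: gens`_j) - a i j *: gens`_j)); last first.
    by move=> j _; rewrite !mxE scalerBl.
  rewrite sumrB -(aP i).2 (bigD1 i) //= big1 ?addr0 ?mxE ?eqxx ?mulr1n ?subrr //.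
  by move=> j ji; rewrite !mxE eq_sym (negPf ji) mulr0n scale0r.
exists (\det A); split.
  have dAB : q (\det A - \det B).
    by apply: prime_det_congr => i j; rewrite !mxE addrAC subrr add0r; apply/(primeN qP)/(aP i).1.
  move=> /(primeBE qP dAB); rewrite det_diag => /(prime_prod qP)[i _]; rewrite mxE; exact: (sP i).1.
move=> m; have [c ->] := span m; rewrite scaler_sumr big1 // => i _.
rewrite scalerA mulrC -scalerA [_ *: gens`_i](_ : _ = 0) ?scaler0 //.
transitivity (\sum_(l < r) (\adj A *m A) i l *: gens`_l).
  rewrite mul_adj_mx (bigD1 i) //= mxE eqxx mulr1n big1 ?addr0 // => l li.
  by rewrite mxE eq_sym (negPf li) mulr0n scale0r.
under eq_bigr => l _ do rewrite mxE scaler_suml.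
rewrite exchange_big big1 // => j _ /=.
under eq_bigr => l _ do rewrite -scalerA.
by rewrite -scaler_sumr Ag scaler0.
Qed.

End Nakayama.

(** * Dimension and regular sequences in a localization *)

Section Localized.
Variables (R : comNzRingType) (p : prime_idealr R) (M : lmodType R).
Local Notation pprime := (prime_idealr_is_prime p).

Definition tofrac (a : R) : locring p := locfrac a (denom1 p).

Lemma tofrac1 : tofrac 1 = 1. Proof. by []. Qed.

Lemma tofracM a b : tofrac (a * b) = tofrac a * tofrac b.
Proof. by rewrite locfracM; apply/locfrac_eq; exists (denom1 p) => /=; ring. Qed.

Lemma tofracD a b : tofrac (a + b) = tofrac a + tofrac b.
Proof. by rewrite locfracD; apply/locfrac_eq; exists (denom1 p) => /=; ring. Qed.

Lemma tofrac_den a (s : denom p) : tofrac a = locfrac a s * tofrac (sval s).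
Proof. by rewrite locfracM; apply/locfrac_eq; exists (denom1 p) => /=; ring. Qed.

Lemma tofrac_num a (s : denom p) : locfrac a s = locfrac 1 s * tofrac a.
Proof. by rewrite locfracM; apply/locfrac_eq; exists (denom1 p) => /=; ring. Qed.

Definition contract (Q : prime_idealr (locring p)) (a : R) := tofrac a \in Q.

Lemma contract_prime Q : is_prime (contract Q).
Proof.
have QP := prime_idealr_is_prime Q; rewrite /contract; split.
- rewrite (_ : tofrac 0 = 0) ?rpred0 //.
- by move=> a b; rewrite tofracD; exact: (primeD QP).
- by move=> a b; rewrite tofracM; exact: (primeMl QP).
- by rewrite tofrac1 idealr1.
- by move=> a b; rewrite tofracM; exact: (primeM QP).
Qed.

Lemma contract_sub Q a : contract Q a -> a \in p.
Proof.
move=> Qa; apply/negPn/negP => ap; pose s : denom p := exist _ a ap.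
apply: (prime1 (contract_prime Q)); rewrite /contract.
rewrite (_ : tofrac 1 = locfrac 1 s * tofrac a); first exact: idealMr.
by rewrite -tofrac_num; apply/locfrac_eq; exists (denom1 p) => /=; ring.
Qed.

Lemma contract_num (Q : prime_idealr (locring p)) a (s : denom p) :
  (locfrac a s \in Q) = contract Q a.
Proof.
apply/idP/idP => h; last by rewrite tofrac_num; exact: idealMr.
by rewrite /contract (tofrac_den a s) mulrC; exact: idealMr.
Qed.

(** Stands for a chain of primes of the localization, each replaced by its contraction. Ann M maps
    into the annihilator of the localized module, so such chains bound its dimension from above. *)
Definition chain_below d (q : nat -> R -> Prop) : Prop :=
  [/\ forall i, is_prime (q i),
      forall i a, (i < d)%N -> q i a -> q i.+1 a,
      forall i, (i < d)%N -> exists a, q i.+1 a /\ ~ q i a,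
      forall i a, q i a -> a \in p &
      forall a, (forall m : M, a *: m = 0) -> q 0%N a].

Lemma dim_loc_chain d : (exists P : nat -> prime_idealr (locring p),
    (forall a, (forall m : loc p M, a *: m = 0) -> a \in P 0%N) /\
    (forall i, (i < d)%N ->
       {subset P i <= P i.+1} /\ exists2 a, a \in P i.+1 & a \notin P i)) ->
  exists q, chain_below d q.
Proof.
move=> [P [PA PS]]; exists (fun i => contract (P i)); split.
- by move=> i; apply: contract_prime.
- by move=> i a /PS[+ _]; apply.
- move=> i /PS[_ [x]]; rewrite -[x]locfracE !contract_num => h /negP h'.
  by exists (locnum x).
- by move=> i a; apply: contract_sub.
move=> a aM; apply: PA => m; rewrite -[m]fracK fracZ aM.
by apply/frac_eq; exists (denom1 p); rewrite !scaler0.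
Qed.

(** This and [regular_at] say that y is a nonzerodivisor on the localization at p, and z one modulo
    y, with all equations written in M itself. *)
Definition nzd_at (y : R) := forall u : M, y *: u = 0 -> exists2 s, s \notin p & s *: u = 0.

Definition regular_at (y z : R) := forall u v : M, z *: u = y *: v ->
  exists2 s, s \notin p & exists w, s *: u = y *: w.

Lemma frac0 (u : M) (s : denom p) : frac u s = 0 <-> exists2 t, t \notin p & t *: u = 0.
Proof.
split=> [/frac_eq[t]|[t tp tu]]; last first.
  by apply/frac_eq; exists (exist _ t tp); rewrite /= scale1r tu !scaler0.
by rewrite /= scale1r !scaler0 => h; exists (sval t) => //; exact: (svalP t).
Qed.

Lemma regular_seq1_step (y : R) (x : loc p M) : nzd_at y -> tofrac y *: x = 0 -> x = 0.
Proof.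
move=> yn; rewrite -[x]fracK fracZ => /frac0[t tp]; rewrite scalerA mulrC -scalerA.
move=> /yn[s sp h]; apply/frac0; exists (s * t); last by rewrite -scalerA.
by rewrite prime_idealrM negb_or sp.
Qed.

Lemma regular_seq2_step (y z : R) (x x' : loc p M) : regular_at y z ->
  tofrac z *: x = tofrac y *: x' -> exists w, x = tofrac y *: w.
Proof.
move=> yz; rewrite -[x]fracK -[x']fracK; set u := locnum x; set s := locden x.
set v := locnum x'; set t := locden x'.
rewrite !fracZ => /frac_eq[r]; rewrite /= !mul1r !scalerA => h.
have [|s' s'p [w wE]] := yz ((sval r * sval t) *: u) ((sval r * sval s) *: v).
  by rewrite !scalerA mulrC h; congr (_ *: _); ring.
pose d : denom p := denomM (denomM (exist _ s' s'p) (denomM r t)) s.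
exists (frac w d); rewrite fracZ; apply/frac_eq; exists (denom1 p).
rewrite /= !scale1r scalerA; move: wE; rewrite scalerA => wE.
rewrite [sval s * y]mulrC.
have -> : 1 * (s' * (sval r * sval t) * sval s) = sval s * (s' * (sval r * sval t)) by ring.
by rewrite -scalerA wE scalerA mulrC.
Qed.

Variable gens : seq M.
Hypothesis span : forall m, exists a : nat -> R, m = \sum_(i < size gens) a i *: gens`_i.

(** Otherwise every element of M has a multiple by a denominator in p M, and by [nakayama] an
    element outside p kills M; but annihilators lie in p. *)
Lemma loc_nakayama (ys : seq R) (q0 : R -> Prop) : {subset ys <= p} ->
  (forall a, q0 a -> a \in p) ->
  (forall a, (forall m : M, a *: m = 0) -> q0 a) ->
  exists m : loc p M, ~ in_seqmod (map tofrac ys) m.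
Proof.
move=> yp q0p q0A; apply: contrapT => /forallNP no.
have [|s [sp sM]] := @nakayama _ M _ pprime gens span; last first.
  by apply: sp; apply: q0p; apply: q0A.
pose pM v := exists a : nat -> R,
  (forall i, a i \in p) /\ v = \sum_(i < size gens) a i *: gens`_i.
have pMD v w : pM v -> pM w -> pM (v + w).
  move=> [a [ap ->]] [b [bp ->]]; exists (fun i => a i + b i); split.
    by move=> i; rewrite rpredD.
  by rewrite -big_split; apply: eq_bigr => i _; rewrite scalerDl.
have pMZ r v : pM v -> pM (r *: v).
  move=> [a [ap ->]]; exists (fun i => r * a i); split.
    by move=> i; apply: idealMr.
  by rewrite scaler_sumr; apply: eq_bigr => i _; rewrite scalerA.
have pMp y v : y \in p -> pM (y *: v).
  move=> yP; have [a ->] := span v; exists (fun i => y * a i); split.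
    by move=> i; rewrite mulrC; apply: idealMr.
  by rewrite scaler_sumr; apply: eq_bigr => i _; rewrite scalerA.
pose N (x : loc p M) := exists v s, pM v /\ x = frac v s.
have NP x : N x.
  have /contrapT[c ->] := no x; rewrite size_map; elim/big_ind: _ => [||i _].
  - exists 0, (denom1 p); split=> //; exists (fun=> 0); split => [_|]; first exact: rpred0.
    by rewrite big1 // => i _; rewrite scale0r.
  - move=> x1 x2 [v [t [vP ->]]] [v' [t' [v'P ->]]].
    by exists (sval t' *: v + sval t *: v'), (denomM t t'); rewrite fracD; split; auto.
  rewrite (nth_map 0) // -[c i]fracK fracZ.
  eexists; eexists; split; last by reflexivity.
  by apply: pMp; apply/yp/mem_nth.
move=> m; have [v [t [vP /frac_eq[r]]]] := NP (frac m (denom1 p)).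
rewrite /= scale1r scalerA => h; exists (sval r * sval t); split.
  by apply/negP; rewrite prime_idealrM negb_or (svalP r) (svalP t).
by rewrite h; apply: pMZ.
Qed.

Lemma tofrac_locmax y : y \in p -> tofrac y \in locmax p.
Proof. by move=> yp; apply/asboolP; exists y, (denom1 p). Qed.

Lemma regular_seq_loc1 y : y \in p -> nzd_at y ->
  (exists m, ~ in_seqmod [:: tofrac y] (m : loc p M)) ->
  regular_seq (loc p M) [:: tofrac y].
Proof.
move=> yp yn yM; split=> // -[|//] m _ /= [c]; rewrite /= big_ord0 => h.
by exists c; rewrite big_ord0; apply: regular_seq1_step yn _.
Qed.

Lemma regular_seq_loc2 y z : y \in p -> z \in p -> nzd_at y -> regular_at y z ->
  (exists m, ~ in_seqmod [:: tofrac y; tofrac z] (m : loc p M)) ->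
  regular_seq (loc p M) [:: tofrac y; tofrac z].
Proof.
move=> yp zp yn yzr yzM; split=> // -[|[|//]] m _ /= [c]; rewrite /= ?big_ord0 ?big_ord1 /= => h.
  by exists c; rewrite big_ord0; apply: regular_seq1_step yn _.
have [w wE] := regular_seq2_step yzr h.
by exists (fun=> w); rewrite big_ord1.
Qed.

End Localized.

(** Only the existence of chains of length 0, 1 and 2 matters for min(2, dim); they call for regular
    sequences of these lengths, the empty one being supplied by Nakayama's lemma. *)
Lemma serre2_criterion (R : comNzRingType) (M : lmodType R) (gens : seq M) :
  (forall m, exists a : nat -> R, m = \sum_(i < size gens) a i *: gens`_i) ->
  (forall (p : prime_idealr R) q, chain_below p M 1 q ->
     exists2 y, y \in p & nzd_at p M y) ->
  (forall (p : prime_idealr R) q, chain_below p M 2 q ->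
     exists y z, [/\ y \in p, z \in p, nzd_at p M y & regular_at p M y z]) ->
  serre 2 M.
Proof.
move=> span h1 h2 p; pose chain d := exists q, chain_below p M d q.
(* For d = 0 this bound is 0 and not -oo, so the case without any chain is treated on its own. *)
have dimP d : (forall d', (d <= d')%N -> ~ chain d') ->
    (dim (loc p M) <= ((d.-1)%:Z)%:E)%E.
  move=> no; apply: nat_sup_le => d' /dim_loc_chain ch.
  by have := leqP d d'; case=> [/no/(_ ch)//|]; case: (d).
have short d d' : (d <= d')%N -> chain d' -> chain d.
  move=> dd' [q [qP qS qN qp qA]]; exists q; split => //.
    by move=> i a id; apply: qS; apply: leq_trans id dd'.
  by move=> i id; apply: qN; apply: leq_trans id dd'.
have nosup d : ~ chain d -> forall d', (d <= d')%N -> ~ chain d'.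
  by move=> no d' dd' /(short _ _ dd').
have [ch0|no0] := pselect (chain 0%N); last first.
  rewrite [dim _](_ : _ = -oo%E); first by rewrite ge_min leNye orbT.
  by apply: nat_sup_lt0 => d /dim_loc_chain; apply: nosup no0 _ _.
have nak ys : {subset ys <= p} -> exists m : loc p M, ~ in_seqmod (map (tofrac p) ys) m.
  by case: ch0 => q [_ _ _ qp qA] ysp; apply: loc_nakayama span _ _ ysp (qp 0%N) qA.
have [ch2|no2] := pselect (chain 2%N).
  have [q qc] := ch2; have [y [z [yp zp yn yz]]] := h2 p q qc.
  apply: (@le_trans _ _ ((2%:Z)%:E)); first by rewrite ge_min lexx.
  apply: nat_sup_ge; exists [:: tofrac p y; tofrac p z]; split => //.
    by move=> x; rewrite !inE => /orP[]/eqP->; apply: tofrac_locmax.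
  apply: regular_seq_loc2 => //; apply: (nak [:: y; z]) => x.
  by rewrite !inE => /orP[]/eqP->.
have [ch1|no1] := pselect (chain 1%N).
  have [q qc] := ch1; have [y yp yn] := h1 p q qc.
  apply: (@le_trans _ _ ((1%:Z)%:E)).
    by rewrite ge_min; apply/orP; right; apply: (dimP 2) => d'; apply: nosup no2 _.
  apply: nat_sup_ge; exists [:: tofrac p y]; split => //.
    by move=> x; rewrite !inE => /eqP->; apply: tofrac_locmax.
  by apply: regular_seq_loc1 => //; apply: (nak [:: y]) => x; rewrite !inE => /eqP->.
apply: (@le_trans _ _ ((0%:Z)%:E)).
  by rewrite ge_min; apply/orP; right; apply: (dimP 1) => d'; apply: nosup no1 _.
apply: nat_sup_ge; exists [::]; split => //; split => //.
exact: (nak [::]).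
Qed.

(** * Factors of polynomials in some of the variables *)

Section FactorsInSubring.
Variables (k : fieldType) (n : nat).
Local Notation S := {mpoly k[n]}.
Implicit Types (f g h : S) (T F : {set 'I_n}).

Lemma subst_restr (s : 'I_n -> S) T f : (forall i, i \in T -> s i = 'X_i) ->
  subst s (restr T f) = restr T f.
Proof.
move=> sT; apply: (mpoly_morph_ext (f := subst s \o restr T) (g := restr T)) => [c|i] /=.
  by rewrite /restr !substC.
by rewrite restrX; case: ifPn => iT; rewrite ?rmorph0 // substX sT.
Qed.

(* Grading by the total degree in the variables outside T. *)
Definition grade T : S -> {poly S} :=
  mmap (polyC \o mpolyC n (R := k)) (fun i => if i \in T then ('X_i)%:P else ('X_i)%:P * 'X).

HB.instance Definition _ T := GRing.RMorphism.on (grade T).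

Lemma gradeX T i : grade T 'X_i = if i \in T then ('X_i)%:P else ('X_i)%:P * 'X.
Proof. by rewrite /grade mmapX mmap1U. Qed.

Lemma gradeC T c : grade T c%:MP = (c%:MP)%:P.
Proof. by rewrite /grade mmapC. Qed.

Lemma horner_grade1 T f : (grade T f).[1] = f.
Proof.
apply: (mpoly_morph_ext (f := horner_eval 1 \o grade T) (g := idfun)) => [c|i] /=.
  by rewrite gradeC /horner_eval hornerC.
by rewrite gradeX /horner_eval; case: ifP => _; rewrite ?hornerMX hornerC ?mulr1.
Qed.

Lemma horner_grade0 T f : (grade T f).[0] = restr T f.
Proof.
apply: (mpoly_morph_ext (f := horner_eval 0 \o grade T) (g := restr T)) => [c|i] /=.
  by rewrite gradeC /horner_eval hornerC /restr substC.
by rewrite gradeX restrX /horner_eval; case: ifP => _; rewrite ?hornerMX hornerC ?mulr0.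
Qed.

Lemma grade_restr T f : grade T (restr T f) = (restr T f)%:P.
Proof.
apply: (mpoly_morph_ext (f := grade T \o restr T) (g := polyC \o restr T)) => [c|i] /=.
  by rewrite /restr substC gradeC.
by rewrite restrX; case: ifPn => iT; rewrite ?rmorph0 // gradeX iT.
Qed.

(** Degrees in the variables outside T add up in a product, and that of f is 0. *)
Lemma restr_factor T f g h : f != 0 -> restr T f = f -> f = g * h -> restr T g = g.
Proof.
move=> f0 fT fE; have : size (grade T g * grade T h) = 1%N.
  by rewrite -rmorphM /= -fE -[in grade T f]fT grade_restr fT size_polyC f0.
have gr0 a : a != 0 -> grade T a != 0.
  by move=> a0; apply: contraNneq a0 => ga; rewrite -(horner_grade1 T a) ga horner0.
have g0 : g != 0 by apply: contraNneq f0 => g0; rewrite fE g0 mul0r.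
have h0 : h != 0 by apply: contraNneq f0 => h0; rewrite fE h0 mulr0.
rewrite size_mul ?gr0 // => sz.
have sg : (size (grade T g) <= 1)%N.
  have arith a b : (a + b).-1 = 1%N -> (0 < b)%N -> (a <= 1)%N by lia.
  by apply: arith sz _; rewrite size_poly_gt0 gr0.
(* Being constant, the graded form of g has equal values at 1 and at 0, namely g and its
   restriction. *)
by rewrite -{2}(horner_grade1 T g) -horner_grade0 (size1_polyC sg) !hornerC.
Qed.

(** Some prime factor of f lies in q, and by [restr_factor] it stays in the variables of T. *)
Lemma prime_element_in_prime (q : S -> Prop) T f : is_prime q -> f != 0 ->
  restr T f = f -> q f -> exists g, [/\ prime_elt g, q g & restr T g = g].
Proof.
move=> qP f0 fT qf; have [u [s [uU sP fE]]] := factorial_mpoly f0.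
have [g gs qg] : exists2 g, g \in s & q g.
  move: qf; rewrite fE => /(primeM qP)[/(prime_unit qP uU)//|].
  elim: s {sP fE} => [|x s IH]; first by rewrite big_nil => /(prime1 qP).
  rewrite big_cons => /(primeM qP)[qx|/IH[g gs qg]]; first by exists x; rewrite ?mem_head.
  by exists g; rewrite // inE gs orbT.
exists g; split => //; first exact: sP.
apply: (restr_factor f0 fT (h := u * \prod_(x <- rem g s) x)).
by rewrite fE (big_rem g gs) /= mulrCA.
Qed.

Lemma restr_setC1_divides i f : restr (~: [set i]) f = 0 -> divides 'X_i f.
Proof.
move=> f0; rewrite -[X in divides _ X]subr0 -f0.
have := @subst_divides k n (fun j => if j \in ~: [set i] then 'X_j else 0) i f.
rewrite !inE eqxx /= subr0 -/(restr _); apply => j ji.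
by rewrite !inE ji.
Qed.

End FactorsInSubring.

(** * Layers of a simplicial complex *)

Section Truncation.
Variables (k : fieldType) (n : nat).
Local Notation S := {mpoly k[n]}.
Implicit Types (P : pred {set 'I_n}) (f g : S) (s F : {set 'I_n}).

Definition trunc P f : S := \sum_(m <- msupp f | P (mset m)) f@_m *: 'X_[m].

Lemma mcoeff_trunc P f m : (trunc P f)@_m = if P (mset m) then f@_m else 0.
Proof.
rewrite /trunc raddf_sum /= big_mkcond /=; case: ifP => Pm; last first.
  rewrite big1 // => m' _; case: ifP => // Pm'; rewrite mcoeffZ mcoeffX.
  by case: eqP => [mm'|]; rewrite ?mulr0 //; rewrite -mm' Pm' in Pm.
rewrite [in RHS](mpolyE f) raddf_sum /=; apply: eq_bigr => m' _.
case: ifP => // Pm'; rewrite mcoeffZ mcoeffX.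
by case: eqP => [mm'|]; rewrite ?mulr0 //; rewrite mm' Pm in Pm'.
Qed.

Lemma truncB P : zmod_morphism (trunc P).
Proof.
move=> f g; apply/mpolyP => m; rewrite mcoeffB !mcoeff_trunc mcoeffB.
by case: ifP => // _; rewrite subr0.
Qed.

HB.instance Definition _ P := GRing.isZmodMorphism.Build S S (trunc P) (truncB P).

Lemma trunc_trunc P Q f : trunc P (trunc Q f) = trunc (fun s => P s && Q s) f.
Proof. by apply/mpolyP => m; rewrite !mcoeff_trunc; case: (P _); case: (Q _). Qed.

Lemma trunc_id P f : (forall m, f@_m != 0 -> P (mset m)) -> trunc P f = f.
Proof.
move=> fP; apply/mpolyP => m; rewrite mcoeff_trunc; case: ifPn => // Pm.
by apply/esym/eqP/negPn; apply: contra Pm => /fP.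
Qed.

Definition varprod F : S := \prod_(j in F) 'X_j.

Lemma varprodE F : varprod F = 'X_[(\sum_(j in F) U_(j))%MM].
Proof. by rewrite /varprod -mprodXE. Qed.

Lemma mset_varprod F : mset (\sum_(j in F) U_(j))%MM = F.
Proof.
apply/setP => i; rewrite inE mnm_sumE; apply/idP/idP => [|iF].
  apply: contraR => iF; rewrite big1 // => j jF; rewrite mnm1E.
  by case: eqP => // ji; rewrite -ji jF in iF.
by rewrite (bigD1 i) //= mnm1E eqxx.
Qed.

Lemma restr_varprod F G : restr G (varprod F) = if F \subset G then varprod F else 0.
Proof. by rewrite varprodE restrXm mset_varprod. Qed.

Lemma varprod_neq0 F : varprod F != 0.
Proof.
rewrite varprodE; apply/eqP => /(congr1 (mcoeff (\sum_(j in F) U_(j))%MM)).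
by rewrite mcoeffX eqxx mcoeff0 => /eqP; rewrite oner_eq0.
Qed.

Lemma mcoeff_varprodM F f m : (varprod F * f)@_m != 0 -> F \subset mset m.
Proof.
move=> /mcoeffM_neq0[m1 [m2 [-> + _]]]; rewrite varprodE mcoeffX.
case: (_ =P m1) => [<- _|_]; last by rewrite eqxx.
by rewrite msetD mset_varprod subsetUl.
Qed.

Lemma trunc_pred1_varprod s f : exists c, trunc (pred1 s) f = c * varprod s.
Proof.
exists (\sum_(m <- msupp f | mset m == s) f@_m *: 'X_[m - \sum_(j in s) U_(j)]).
rewrite /trunc mulr_suml; apply: eq_bigr => m /eqP ms.
rewrite -scalerAl varprodE -mpolyXD submK //; apply/mnm_lepP => i.
rewrite mnm_sumE; case: (boolP (i \in s)) => iS.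
  rewrite (bigD1 i) //= mnm1E eqxx big1 ?addn0; last first.
    by move=> j /andP[_ ji]; rewrite mnm1E (negPf ji).
  by rewrite -ms inE -lt0n in iS.
by rewrite big1 // => j js; rewrite mnm1E; case: eqP => // ji; rewrite -ji js in iS.
Qed.

Lemma sum_trunc_pred1 f : f = \sum_s trunc (pred1 s) f.
Proof.
apply/mpolyP => m; rewrite raddf_sum /= (bigD1 (mset m)) //= mcoeff_trunc /= eqxx.
by rewrite big1 ?addr0 // => s sm; rewrite mcoeff_trunc /= eq_sym (negPf sm).
Qed.

End Truncation.

(** * Largest faces and layers *)

Section MaxFace.
Variables (n : nat) (D : {set {set 'I_n}}).
Implicit Types (s t F : {set 'I_n}).

Definition max_face s : nat := \max_(F in D | s \subset F) #|F|.

Lemma max_face_ge s F : F \in D -> s \subset F -> (#|F| <= max_face s)%N.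
Proof.
move=> FD sF; apply: (@leq_bigmax_cond _ (fun F => (F \in D) && (s \subset F)) (fun F => #|F|)).
by rewrite FD.
Qed.

Lemma max_faceP s : s \in D -> exists2 F, F \in D /\ s \subset F & #|F| = max_face s.
Proof.
move=> sD.
have [|F] := @eq_bigmax_cond _ (fun F => (F \in D) && (s \subset F)) (fun F => #|F|).
  by apply/card_gt0P; exists s; rewrite unfold_in /= sD subxx.
by rewrite unfold_in /= => /andP[FD sF] FE; exists F.
Qed.

Lemma max_face_anti s t : s \subset t -> (max_face t <= max_face s)%N.
Proof.
move=> st; apply/bigmax_leqP => F /andP[FD tF].
by apply: max_face_ge => //; apply: subset_trans tF.
Qed.

Definition layer d : {set {set 'I_n}} := [set s in D | max_face s == d].

Lemma layer_facet d s : s \in layer d ->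
  exists F, [/\ F \in D, F \in layer d, s \subset F & #|F| = d].
Proof.
rewrite inE => /andP[/max_faceP[F [FD sF] FE] /eqP sd]; exists F; split=> //; last by rewrite FE.
rewrite inE FD eqn_leq -{1}sd max_face_anti //= -sd -FE; exact: max_face_ge.
Qed.

End MaxFace.

(* rep identifies M with the span of the monomials whose support lies in the
   layer, on which a product is cut off to that span. *)
Record layer_module (k : fieldType) n (D : {set {set 'I_n}}) d
    (M : lmodType {mpoly k[n]}) (rep : M -> {mpoly k[n]}) : Prop := LayerModule {
  repB : zmod_morphism rep;
  repZ : forall f x, rep (f *: x) = trunc (fun s => s \in layer D d) (f * rep x);
  rep_inj : forall x, rep x = 0 -> x = 0;
  rep_surj : forall f, exists x, rep x = trunc (fun s => s \in layer D d) f }.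

(** * Modules spanned by the monomials of a layer *)

Section MonomialModule.
Variables (k : fieldType) (n : nat) (D : {set {set 'I_n}}) (d : nat).
Hypothesis D_closed : forall F G : {set 'I_n}, G \in D -> F \subset G -> F \in D.
Local Notation S := {mpoly k[n]}.
Local Notation Gam := (layer D d).
Local Notation inGam := (fun s : {set 'I_n} => s \in Gam).
Implicit Types (F G T s : {set 'I_n}).
Variables (M : lmodType S) (rep : M -> S).
Hypothesis repP : layer_module D d rep.

Lemma rep0 : rep 0 = 0.
Proof. by rewrite -(subrr 0) (repB repP) subrr. Qed.

Lemma repI x y : rep x = rep y -> x = y.
Proof.
move=> xy; apply/eqP; rewrite -subr_eq0; apply/eqP/(rep_inj repP).
by rewrite (repB repP) xy subrr.
Qed.

Lemma mcoeff_rep x m : (rep x)@_m != 0 -> mset m \in Gam.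
Proof.
rewrite -[x]scale1r (repZ repP) mcoeff_trunc.
by case: ifP => //; rewrite eqxx.
Qed.

(** The cut-off is invisible in k[x_F]: a multiple of a layer monomial has [max_face] at most d, and
    if supported in F at least |F|, so it is still in the layer. *)
Lemma restr_rep F f x : F \in D -> (d <= #|F|)%N ->
  restr F (rep (f *: x)) = restr F f * restr F (rep x).
Proof.
move=> FD dF; rewrite -rmorphM /= (repZ repP).
apply/mpolyP => m; rewrite !mcoeff_restr; case: ifPn => // mF.
rewrite mcoeff_trunc; case: ifPn => // mG.
apply/esym/eqP/negPn/negP => /mcoeffM_neq0[m1 [m2 [mE _ /mcoeff_rep]]].
rewrite inE => /andP[m2D /eqP m2d]; case/negP: mG; rewrite inE (D_closed FD mF).
rewrite eqn_leq -{1}m2d mE max_face_anti ?msetD ?subsetUr //= -msetD -mE.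
by apply: leq_trans dF _; apply: max_face_ge.
Qed.

(** Every monomial of the layer is supported in a facet of size d, by [layer_facet]. *)
Lemma rep_eq0 x : (forall F, F \in D -> F \in Gam -> #|F| = d -> restr F (rep x) = 0) -> x = 0.
Proof.
move=> h; apply: (rep_inj repP); apply/mpolyP => m; rewrite mcoeff0.
apply/eqP/negPn/negP => mx; have [F [FD FG mF Fd]] := layer_facet (mcoeff_rep mx).
have := congr1 (mcoeff m) (h F FD FG Fd); rewrite mcoeff_restr mF mcoeff0.
exact/eqP.
Qed.

Lemma rep_big F x : F \in D -> (d < max_face D F)%N -> restr F (rep x) = 0.
Proof.
move=> FD dF; apply/mpolyP => m; rewrite mcoeff_restr mcoeff0; case: ifP => // mF.
apply/eqP/negPn/negP => /mcoeff_rep; rewrite inE => /andP[_ /eqP md].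
by have := max_face_anti D mF; rewrite md leqNgt dF.
Qed.

(** The generators represent the squarefree monomials; those with support outside the layer become
    0. *)
Lemma rep_span : exists gens : seq M, forall x, exists a : nat -> S,
  x = \sum_(i < size gens) a i *: gens`_i.
Proof.
have /choice[g gP] : forall s : {set 'I_n}, exists x, rep x = trunc inGam (varprod k s).
  by move=> s; apply: (rep_surj repP).
have repD : forall x y, rep (x + y) = rep x + rep y.
  by move=> x y; rewrite -{1}(opprK y) (repB repP) -{1}(sub0r y) (repB repP) rep0 sub0r opprK.
exists [seq g s | s <- index_enum {set 'I_n}] => x.
have /choice[a aE] := fun s => trunc_pred1_varprod s (rep x).
exists (fun i => a (nth set0 (index_enum {set 'I_n}) i)).
apply: repI; set y := \sum_(_ < _) _.
have -> : y = \sum_s a s *: g s.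
  rewrite /y size_map (big_nth set0) big_mkord.
  by apply: eq_bigr => i _; rewrite (nth_map set0).
rewrite (big_morph rep repD rep0).
rewrite {1}[rep x]sum_trunc_pred1.
apply: eq_bigr => s _; rewrite (repZ repP) gP.
apply/mpolyP => m; rewrite mcoeff_trunc [RHS]mcoeff_trunc.
case: (boolP (s \in Gam)) => sG; last first.
  rewrite (_ : trunc inGam (varprod k s) = 0); last first.
    apply/mpolyP => m'; rewrite mcoeff_trunc mcoeff0 varprodE mcoeffX.
    case: ifP => // mG; case: eqP => // mE; move: mG.
    by rewrite -mE mset_varprod (negPf sG).
  rewrite mulr0 mcoeff0 if_same /=; case: eqP => // ms.
  by apply/eqP/negPn; apply: contra sG => /mcoeff_rep; rewrite ms.
rewrite (_ : trunc inGam (varprod k s) = varprod k s); last first.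
  apply: trunc_id => m'; rewrite varprodE mcoeffX; case: (_ =P m') => [<- _|_]; last by rewrite eqxx.
  by rewrite mset_varprod.
rewrite -aE mcoeff_trunc /=; case: eqP => [->|]; last by rewrite if_same.
by rewrite sG.
Qed.

End MonomialModule.

(** * Regular sequences on a layer module *)

Section LayerRegular.
Variables (k : fieldType) (n : nat) (D : {set {set 'I_n}}) (d : nat).
Hypothesis D_closed : forall F G : {set 'I_n}, G \in D -> F \subset G -> F \in D.
Local Notation S := {mpoly k[n]}.
Local Notation Gam := (layer D d).
Implicit Types (F G T s : {set 'I_n}).
Variables (M : lmodType S) (rep : M -> S).
Hypothesis repP : layer_module D d rep.
Variable T : {set 'I_n}.

(** Faces larger than d are included, although the module restricts to 0 on them: a chain of faces
    joining two facets may pass through them. *)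
Definition big_face F := [/\ F \in D, T \subset F & (d <= #|F|)%N].

(** The product of the variables in T kills the components at facets not containing T; at the others
    y is a nonzero element of a domain. *)
Lemma layer_nzd y (u : M) :
  (forall F, big_face F -> #|F| = d -> restr F y != 0) ->
  y *: u = 0 -> varprod k T *: u = 0.
Proof.
move=> yF yu; apply: (rep_eq0 repP) => F FD FG Fd.
rewrite (restr_rep D_closed repP) ?Fd // restr_varprod; case: ifP => TF; last by rewrite mul0r.
have := restr_rep D_closed repP y u FD; rewrite Fd leqnn yu (rep0 repP) rmorph0.
move=> /(_ isT)/esym/eqP; rewrite mulf_eq0 (negPf (yF _ _ _)) //=; last by split=> //; rewrite Fd.
by move=> /eqP->; rewrite mulr0.
Qed.

(* The quotients of the restrictions of u by those of y agree on the
   intersections where y does not vanish, and therefore glue. *)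
Lemma layer_regular y z (u v : M) :
  (forall F, big_face F -> #|F| = d -> forall g h,
     restr F z * g = restr F y * h -> divides (restr F y) g) ->
  (forall F F', big_face F -> big_face F' -> exists C, [/\ big_face C,
     F :&: F' \subset C, restr (F :&: C) y != 0 & restr (C :&: F') y != 0]) ->
  z *: u = y *: v -> exists w, varprod k T *: u = y *: w.
Proof.
move=> yz conn zu.
have restr_neq0 G F (f : S) : G \subset F -> restr G f != 0 -> restr F f != 0.
  by move=> GF; apply: contraNneq => Ff; rewrite -(restr_id _ GF) Ff rmorph0.
have yF F : big_face F -> restr F y != 0.
  by move=> bF; have [C [_ _ + _]] := conn F F bF bF; apply: restr_neq0; apply: subsetIl.
(* On a facet of size d the quotient comes from the divisibility hypothesis; on any other big face u
   restricts to 0, and so does the quotient. *)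
have /choice[w wP] : forall F, exists w, big_face F ->
    restr F w = w /\ restr F (rep u) = restr F y * w.
  move=> F; have [bF|] := pselect (big_face F); last by exists 0.
  have [FD TF dF] := bF; have := max_face_ge FD (subxx F).
  rewrite leq_eqVlt => /predU1P[Fm|Fm].
    have [Fd|/negbTE Fd] := eqVneq #|F| d; last first.
      exists 0 => _; rewrite rmorph0 mulr0; split => //; apply: (rep_big repP) => //.
      by rewrite -Fm ltn_neqAle eq_sym Fd.
    have [|c cE] := yz F bF Fd (restr F (rep u)) (restr F (rep v)).
      by rewrite -!(restr_rep D_closed repP) // zu.
    exists (restr F c) => _; split; first by rewrite restr_id.
    by rewrite -rmorphM /= -[LHS](restr_id (rep u) (subxx F)) cE !rmorphM /= restr_id.
  exists 0 => _; rewrite rmorph0 mulr0; split => //; apply: (rep_big repP) => //.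
  exact: leq_ltn_trans Fm.
have w_big F : big_face F -> (d < #|F|)%N -> w F = 0.
  move=> bF dF; have [FD _ _] := bF; have [_ /esym/eqP] := wP F bF.
  rewrite (rep_big repP u FD) ?mulf_eq0 ?(negPf (yF F bF)) /=; first by move/eqP.
  by apply: leq_trans dF _; apply: max_face_ge.
have glue1 F F' : big_face F -> big_face F' -> restr (F :&: F') y != 0 ->
    restr (F :&: F') (w F) = restr (F :&: F') (w F').
  move=> bF bF' y0; apply: (mulfI y0).
  have key G H : big_face H -> G \subset H -> restr G y * restr G (w H) = restr G (rep u).
    move=> bH GH; rewrite -(restr_id y GH) -rmorphM /= -(wP H bH).2.
    exact: restr_id.
  by rewrite !key ?subsetIl ?subsetIr.
(* The comparison passes through C, which contains the intersection and hence the monomial, while y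
   is nonzero on both F :&: C and C :&: F'. *)
have glue F F' m : big_face F -> big_face F' -> mset m \subset F -> mset m \subset F' ->
    (varprod k T * w F)@_m = (varprod k T * w F')@_m.
  move=> bF bF' mF mF'; have [C [bC FC y1 y2]] := conn F F' bF bF'.
  have mC : mset m \subset C by apply: subset_trans FC; rewrite subsetI mF.
  have step G H : big_face G -> big_face H -> mset m \subset G -> mset m \subset H ->
      restr (G :&: H) y != 0 -> (varprod k T * w G)@_m = (varprod k T * w H)@_m.
    move=> bG bH mG mH y0.
    have E f : f@_m = (restr (G :&: H) f)@_m by rewrite mcoeff_restr subsetI mG mH.
    by rewrite E [RHS]E !rmorphM /= glue1.
  by rewrite (step F C) // (step C F').
have /choice[fc fcP] : forall s, exists F, s \in Gam ->
    [/\ F \in D, F \in Gam, s \subset F & #|F| = d].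
  move=> s; case: (boolP (s \in Gam)) => [/layer_facet[F FP]|]; first by exists F.
  by exists set0.
(* For each support containing T the coefficients are taken from one chosen facet; by [glue] the
   choice does not matter. *)
pose W := \sum_(s in Gam | T \subset s) trunc (pred1 s) (varprod k T * w (fc s)).
have WE m : W@_m = if (mset m \in Gam) && (T \subset mset m)
    then (varprod k T * w (fc (mset m)))@_m else 0.
  rewrite /W raddf_sum /=; case: ifP => mGT.
    rewrite (bigD1 (mset m)) //= mcoeff_trunc /= eqxx big1 ?addr0 // => s /andP[_ sm].
    by rewrite mcoeff_trunc /= eq_sym (negPf sm).
  rewrite big1 // => s sGT; rewrite mcoeff_trunc /=; case: eqP => // ms.
  by rewrite ms sGT in mGT.
have [x xE] := rep_surj repP W; exists x.
have {}xE : rep x = W.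
  by rewrite xE; apply: trunc_id => m; rewrite WE; case: ifP => [/andP[]//|_]; rewrite eqxx.
apply/eqP; rewrite -subr_eq0; apply/eqP/(rep_eq0 repP) => F FD FG Fd.
rewrite (repB repP) rmorphB /= !(restr_rep D_closed repP) ?Fd // xE restr_varprod.
case: ifPn => TF; last first.
  rewrite mul0r (_ : restr F W = 0) ?mulr0 ?subrr //; apply/mpolyP => m.
  rewrite mcoeff_restr mcoeff0 WE; case: ifP => // mF; case: ifP => // /andP[_ Tm].
  by case/negP: TF; apply: subset_trans mF.
have bF : big_face F by split; rewrite ?Fd.
rewrite (wP F bF).2 (_ : restr F W = varprod k T * w F).
  by apply/eqP; rewrite subr_eq0; apply/eqP; ring.
apply/mpolyP => m; rewrite mcoeff_restr WE; case: ifPn => mF; last first.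
  have E : restr F (varprod k T * w F) = varprod k T * w F.
    by rewrite rmorphM /= restr_varprod TF (wP F bF).1.
  by rewrite -E mcoeff_restr (negPf mF).
case: (boolP (T \subset mset m)) => Tm; rewrite ?andbF ?andbT; last first.
  by apply/esym/eqP/negPn; apply: contra Tm; apply: mcoeff_varprodM.
case: ifPn => mG.
  have [gD gG mg gd] := fcP _ mG; apply: glue => //; split=> //; last by rewrite gd.
  exact: subset_trans Tm mg.
(* A monomial supported in F but outside the layer lies in a face G larger than d, where the
   quotient is 0. *)
have mD : mset m \in D by apply: D_closed mF.
have [G [GD mGs] Gm] := max_faceP mD.
have dG : (d < #|G|)%N.
  rewrite Gm ltn_neqAle eq_sym; move: mG; rewrite inE mD /= => -> /=.
  by rewrite -Fd; apply: max_face_ge.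
have bG : big_face G by split=> //; [exact: subset_trans Tm mGs|exact: ltnW].
by rewrite (glue F G) // w_big // mulr0 mcoeff0.
Qed.

End LayerRegular.

(** * Symmetric polynomials in the outer variables *)

Section OuterSum.
Variables (k : fieldType) (n : nat) (T : {set 'I_n}).
Local Notation S := {mpoly k[n]}.
Implicit Types (F G : {set 'I_n}).

Definition outer_sum : S := \sum_(i in ~: T) 'X_i.

(** The sum of all elementary symmetric polynomials of positive degree. That it does not vanish
    modulo the sum of at least two variables can be checked at one point, over any field. *)
Definition outer_prod : S := \prod_(i in ~: T) (1 + 'X_i) - 1.

Lemma restr_outer_sum G : restr G outer_sum = \sum_(i in G :\: T) 'X_i.
Proof.
rewrite /outer_sum rmorph_sum /= [RHS]big_mkcond [LHS]big_mkcond /=.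
apply: eq_bigr => i _; rewrite restrX !inE; case: (i \in T) => //=.
Qed.

Lemma restr_outer_prod G : restr G outer_prod = \prod_(i in G :\: T) (1 + 'X_i) - 1.
Proof.
rewrite /outer_prod rmorphB rmorph1 rmorph_prod /=; congr (_ - _).
rewrite [RHS]big_mkcond [LHS]big_mkcond /=; apply: eq_bigr => i _.
by rewrite rmorphD rmorph1 /= restrX !inE; case: (i \in T) => //=; case: ifP; rewrite ?addr0.
Qed.

Lemma restr_outer_sum_neq0 G i : i \in G -> i \notin T -> restr G outer_sum != 0.
Proof.
move=> iG iT; rewrite restr_outer_sum; apply/eqP => /(congr1 (mcoeff U_(i))).
rewrite mcoeff0 raddf_sum /= (bigD1 i) ?inE ?iG ?iT //= mcoeffX eqxx big1 ?addr0.
  by move/eqP; rewrite oner_eq0.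
by move=> j /andP[_ ji]; rewrite mcoeffX eq_mnm1 (negPf ji).
Qed.

(** Solves the vanishing of the outer sum on F for the i-th variable; applying it amounts to working
    modulo that linear form. *)
Definition eliminate F i : 'I_n -> S := fun j =>
  if j == i then - \sum_(l in (F :\: T) :\ i) 'X_l else 'X_j.

Variables (F : {set 'I_n}) (i : 'I_n).
Hypotheses (iF : i \in F) (iT : i \notin T).

Lemma eliminate_self : eliminate F i i = - \sum_(l in (F :\: T) :\ i) 'X_l.
Proof. by rewrite /eliminate eqxx. Qed.

Lemma eliminate_other j : j != i -> eliminate F i j = 'X_j.
Proof. by rewrite /eliminate => /negPf->. Qed.

Lemma outer_sum_eliminate : restr F outer_sum = 'X_i - eliminate F i i.
Proof.
by rewrite restr_outer_sum (big_setD1 i) ?inE ?iF ?iT //= eliminate_self opprK.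
Qed.

Lemma eliminate_outer_sum : subst (eliminate F i) (restr F outer_sum) = 0.
Proof.
rewrite outer_sum_eliminate rmorphB /= substX eliminate_self rmorphN rmorph_sum /=.
apply/eqP; rewrite subr_eq0; apply/eqP; congr (- _).
apply: eq_bigr => l; rewrite in_setD1 => /andP[li _].
by rewrite substX eliminate_other.
Qed.

Lemma divides_outer_sum f : subst (eliminate F i) f = 0 -> divides (restr F outer_sum) f.
Proof.
move=> f0; rewrite outer_sum_eliminate -[f]subr0 -f0; apply: subst_divides => j ji.
exact: eliminate_other.
Qed.

(* At the point with i-th coordinate -1, j-th coordinate 1, and 0 elsewhere, the
   sum vanishes and the product part is 0 - 1. *)
Lemma eliminate_outer_prod j : j \in F -> j \notin T -> j != i ->
  subst (eliminate F i) (restr F outer_prod) != 0.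
Proof.
move=> jF jT ji; set v := fun l : 'I_n => (l == j)%:R : k.
have sumE : (\sum_(l in (F :\: T) :\ i) 'X_l : S).@[v] = 1.
  rewrite rmorph_sum (bigD1 j) ?inE ?jF ?jT ?ji //= mevalXU /v eqxx big1 ?addr0 //.
  by move=> l /andP[_ /negPf lj]; rewrite mevalXU lj.
apply/eqP => /(congr1 (meval v)).
rewrite meval0 restr_outer_prod rmorphB rmorph1 rmorph_prod /= (big_setD1 i) /=; last first.
  by rewrite !inE iF iT.
rewrite mevalB mevalM rmorphD rmorph1 /= substX eliminate_self mevalD meval1 mevalN sumE.
by rewrite subrr mul0r add0r => /eqP; rewrite oppr_eq0 oner_eq0.
Qed.

End OuterSum.

(** * Serre's condition for a layer module *)

Section LayerSerre.
Variables (k : fieldType) (n : nat) (D : {set {set 'I_n}}) (d : nat).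
Hypothesis D_closed : forall F G : {set 'I_n}, G \in D -> F \subset G -> F \in D.
Hypothesis D_connected : forall A B, A \in D -> B \in D ->
  (d <= #|A|)%N -> (d <= #|B|)%N -> (#|A :&: B| + 2 <= d)%N ->
  exists C, [/\ C \in D, (d <= #|C|)%N, A :&: B \subset C,
    A :&: B \proper A :&: C & A :&: B \proper C :&: B].
Local Notation S := {mpoly k[n]}.
Local Notation Gam := (layer D d).
Implicit Types (F G T s : {set 'I_n}).
Variables (M : lmodType S) (rep : M -> S).
Hypothesis repP : layer_module D d rep.

(** The product of the variables not in q is not in q, so it does not kill M. Some layer monomial is
    therefore divisible by it, and a facet above that monomial is as required. *)
Lemma annihilator_facet (q : S -> Prop) : is_prime q ->
  (forall a, (forall m : M, a *: m = 0) -> q a) ->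
  exists F, [/\ F \in D, F \in Gam, #|F| = d & forall j, j \notin F -> q 'X_j].
Proof.
move=> qP qA; pose T := [set j | `[< ~ q 'X_j >]].
have : ~ q (varprod k T).
  by move=> /(prime_prod qP)[j]; rewrite inE => /asboolP.
move=> /(contra_not (qA _))/existsNP[u /eqP uT].
have [m mu] : exists m, (rep (varprod k T *: u))@_m != 0.
  apply: contrapT => /forallNP no; case/eqP: uT; apply: (rep_inj repP).
  by apply/mpolyP => m; rewrite mcoeff0; apply/eqP/negPn/negP/no.
have [F [FD FG mF Fd]] := layer_facet (mcoeff_rep repP mu).
exists F; split => // j jF; apply: contrapT => qj; case/negP: jF.
apply: (subsetP mF); move: mu; rewrite (repZ repP) mcoeff_trunc.
case: ifP => _; last by rewrite eqxx.
by move=> /mcoeff_varprodM/subsetP; apply; rewrite inE; apply/asboolP.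
Qed.

Lemma varprod_notin (p : prime_idealr S) T : (forall j, j \in T -> 'X_j \notin p) ->
  varprod k T \notin p.
Proof.
move=> Tp; apply/negP => /(prime_prod (prime_idealr_is_prime p))[j /Tp].
by move=> /negP.
Qed.

Definition outside (p : prime_idealr S) : {set 'I_n} := [set j | 'X_j \notin p].

Lemma chain_facet (p : prime_idealr S) r q : chain_below p M r q ->
  exists F, [/\ F \in D, #|F| = d, outside p \subset F & forall j, j \notin F -> q 0%N 'X_j].
Proof.
move=> [qP _ _ qp qA]; have [F [FD FG Fd Fq]] := annihilator_facet (qP 0%N) qA.
exists F; split => //; apply/subsetP => j; rewrite inE; apply: contraR => /Fq.
exact: qp.
Qed.

Lemma outer_sum_in (p : prime_idealr S) : outer_sum k (outside p) \in p.
Proof.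
apply: (prime_sum (prime_idealr_is_prime p)) => j.
by rewrite !inE negbK.
Qed.

Lemma nzd_at_outside (p : prime_idealr S) y :
  (forall F, big_face D d (outside p) F -> #|F| = d -> restr F y != 0) -> nzd_at p M y.
Proof.
move=> yF u yu; exists (varprod k (outside p)); last exact: (layer_nzd D_closed repP yF).
by apply: varprod_notin => j; rewrite inE.
Qed.

Lemma regular_at_outside (p : prime_idealr S) y z :
  (forall F, big_face D d (outside p) F -> #|F| = d -> forall g h,
     restr F z * g = restr F y * h -> divides (restr F y) g) ->
  (forall F F', big_face D d (outside p) F -> big_face D d (outside p) F' ->
     exists C, [/\ big_face D d (outside p) C,
     F :&: F' \subset C, restr (F :&: C) y != 0 & restr (C :&: F') y != 0]) ->
  nzd_at p M y /\ regular_at p M y z.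
Proof.
move=> yz conn; split.
  apply: nzd_at_outside => F bF _; have [C [_ _ + _]] := conn F F bF bF.
  by apply: contraNneq => Fy; rewrite -(restr_id _ (subsetIl F C)) Fy rmorph0.
move=> u v zu; have [w wE] := layer_regular D_closed repP yz conn zu.
exists (varprod k (outside p)); last by exists w.
by apply: varprod_notin => j; rewrite inE.
Qed.

(** All intersections contain T, so y restricts to itself on them, and F' serves as the joining
    face. *)
Lemma restr_conn T (y : S) : restr T y = y -> y != 0 ->
  forall F F', big_face D d T F -> big_face D d T F' ->
  exists C, [/\ big_face D d T C, F :&: F' \subset C, restr (F :&: C) y != 0 &
    restr (C :&: F') y != 0].
Proof.
move=> yT y0 F F' bF bF'; exists F'; rewrite subsetIr setIid -yT.
have [[_ TF _] [_ TF' _]] := (bF, bF').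
by split; rewrite ?restr_sub ?yT // subsetI TF.
Qed.

Lemma two_outer_vertices T F : T \subset F -> (#|T| + 2 <= #|F|)%N ->
  exists i j, [/\ i \in F, i \notin T, j \in F, j \notin T & j != i].
Proof.
move=> TF cF.
have c2 : (2 <= #|F :\: T|)%N.
  by rewrite -(leq_add2l #|F :&: T|) cardsID (setIidPr TF).
have /card_gt0P[i] : (0 < #|F :\: T|)%N by apply: leq_trans c2.
move=> iFT; have /card_gt0P[j] : (0 < #|(F :\: T) :\ i|)%N.
  by move: c2; rewrite (cardsD1 i) iFT.
move: iFT; rewrite !inE => /andP[iT iF] /and3P[ji jT jF].
by exists i, j.
Qed.

Lemma outer_vertex T F : T \subset F -> (#|T| < #|F|)%N ->
  exists i, i \in F /\ i \notin T.
Proof.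
move=> TF cF; have /subsetPn[i iF iT] : ~~ (F \subset T).
  by apply/negP => /subset_leq_card; rewrite leqNgt cF.
by exists i.
Qed.

(** A facet of size d has two vertices outside T. Eliminating one of their variables by means of the
    sum leaves the other polynomial nonzero, so it is a nonzerodivisor modulo the sum. *)
Lemma regular_outer (p : prime_idealr S) : (#|outside p| + 2 <= d)%N ->
  exists y z, [/\ y \in p, z \in p, nzd_at p M y & regular_at p M y z].
Proof.
set T := outside p => Td; exists (outer_sum k T), (outer_prod k T).
have [||yn yr] := @regular_at_outside p (outer_sum k T) (outer_prod k T).
- move=> F [FD TF _] Fd g h E.
  have [|i [j [iF iT jF jT ji]]] := two_outer_vertices TF; first by rewrite Fd.
  apply: (divides_outer_sum iF iT); move/(congr1 (subst (eliminate k T F i))): E.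
  rewrite !rmorphM /= eliminate_outer_sum // mul0r => /eqP.
  by rewrite mulf_eq0 (negPf (eliminate_outer_prod k iF iT jF jT ji)) => /eqP.
- move=> F F' bF bF'; have [[FD TF dF] [F'D TF' dF']] := (bF, bF').
  have sub : T \subset F :&: F' by rewrite subsetI TF.
  have nz G : T \proper G -> restr G (outer_sum k T) != 0.
    by move=> /properP[_ [i iG iT]]; apply: restr_outer_sum_neq0 iG iT.
  (* The sum vanishes on a face containing T only if that face is T. So F' itself serves unless F
     :&: F' = T, and then [D_connected] applies. *)
  have := sub; rewrite subEproper => /predU1P[TE|Tpr]; last first.
    exists F'; rewrite subsetIr setIid; split=> //; apply: nz => //.
    exact: proper_sub_trans Tpr (subsetIr _ _).
  have [|C [CD dC sC p1 p2]] := D_connected FD F'D dF dF'; first by rewrite -TE.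
  exists C; rewrite -TE in sC p1 p2 *; split => //; try exact: nz.
split=> //; first exact: outer_sum_in.
have pP := prime_idealr_is_prime p.
(* Modulo p the polynomial equals its restriction to T, an empty product minus 1. *)
have : outer_prod k T - restr T (outer_prod k T) \in p.
  by apply: (prime_restrB pP) => i; rewrite inE negbK.
by rewrite restr_outer_prod setDv big_set0 subrr subr0.
Qed.

(** Elimination modulo the outer sum fixes y, so an equation between multiples of the two forces the
    sum to divide the cofactor of y; cancelling the sum shows that y divides the other cofactor. *)
Lemma regular_inner_outer (p : prime_idealr S) y : (#|outside p| < d)%N ->
  y \in p -> restr (outside p) y = y -> y != 0 ->
  exists y z, [/\ y \in p, z \in p, nzd_at p M y & regular_at p M y z].
Proof.
set T := outside p => Td yp yT y0; exists y, (outer_sum k T).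
have [|yn yr] := @regular_at_outside p y (outer_sum k T) _ (restr_conn yT y0).
  move=> F [FD TF _] Fd g h.
  have [|i [iF iT]] := outer_vertex TF; first by rewrite Fd.
  have -> : restr F y = y by rewrite -yT restr_sub.
  have elY : subst (eliminate k T F i) y = y.
    rewrite -yT subst_restr // => j jT; apply: eliminate_other.
    by apply: contraNneq iT => <-.
  move=> E; have [|h' hE] := @divides_outer_sum k n T F i iF iT h.
    move/(congr1 (subst (eliminate k T F i))): E.
    rewrite !rmorphM /= eliminate_outer_sum // mul0r elY => /esym/eqP.
    by rewrite mulf_eq0 (negPf y0) => /eqP.
  exists h'; apply: (mulfI (restr_outer_sum_neq0 k iF iT)).
  by rewrite E hE; ring.
by split=> //; exact: outer_sum_in.
Qed.

(** Here T is the only face of size d that contains T, and y is a prime element not dividing z. *)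
Lemma regular_inner (p : prime_idealr S) y z : #|outside p| = d ->
  y \in p -> z \in p -> restr (outside p) y = y -> restr (outside p) z = z ->
  prime_elt y -> ~ divides y z ->
  exists y z, [/\ y \in p, z \in p, nzd_at p M y & regular_at p M y z].
Proof.
set T := outside p => Td yp zp yT zT [y0 _ yM] yz; exists y, z.
have [|yn yr] := @regular_at_outside p y z _ (restr_conn yT y0); last by split.
move=> F [FD TF _] Fd g h.
have -> : F = T by apply/esym/eqP; rewrite eqEcard TF Fd Td leqnn.
by rewrite yT zT => E; have [|/yz|] := yM z g; first by exists h.
Qed.

Section Chain.
Variables (p : prime_idealr S) (r : nat) (q : nat -> S -> Prop).
Hypotheses (qc : chain_below p M r q) (F : {set 'I_n}) (Fd : #|F| = d)
  (TF : outside p \subset F) (Fq : forall j, j \notin F -> q 0%N 'X_j).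

Lemma chain_vars i j : (i <= r)%N -> j \notin F -> q i 'X_j.
Proof.
have [_ qS _ _ _] := qc.
by elim: i => [|i IH] ir jF; [exact: Fq|apply: qS => //; apply: IH (ltnW ir) jF].
Qed.

Lemma chain_step i : (i < r)%N -> exists a, [/\ restr F a = a, q i.+1 a & ~ q i a].
Proof.
have [qP _ qN _ _] := qc => ir; have [a [a1 a0]] := qN i ir.
exists (restr F a); split; first exact: restr_sub.
  by apply/(prime_restr (qP _)) => // j; apply: chain_vars.
by move=> /(prime_restr (qP _) (fun j => chain_vars (ltnW ir) (j := j))).
Qed.

Lemma chain_prime_element : (0 < r)%N ->
  exists y, [/\ restr F y = y, q 1%N y, y != 0 & prime_elt y].
Proof.
have [qP _ _ _ _] := qc => r0; have [a [aF a1 a0]] := chain_step r0.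
have an0 : a != 0 by apply/eqP => a00; apply: a0; rewrite a00; apply: prime0 (qP 0%N).
have [y [yP y1 yF]] := prime_element_in_prime (qP 1%N) an0 aF a1.
by exists y; have [y0 _ _] := (yP).
Qed.

(* If p contained no polynomial in the variables outside it, it would be
   generated by the variables, and only one variable is not already in q 0. *)
Lemma chain_inner_element : (1 < r)%N -> (#|outside p|.+1 = d)%N ->
  exists y, [/\ y \in p, restr (outside p) y = y & y != 0].
Proof.
set T := outside p => r1 Td; have [qP qS _ qp _] := qc.
have pP := prime_idealr_is_prime p.
have pT f : f \in p -> restr T f \in p.
  by move=> fp; apply/(prime_restr pP) => // j; rewrite inE negbK.
apply: contrapT => /forallNP no.
have p0 f : f \in p -> restr T f = 0.
  move=> fp; apply/eqP/negPn/negP => f0; apply: (no (restr T f)).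
  by split; [exact: pT|exact: restr_sub|].
have [v vE] : exists v, F :\: T = [set v].
  apply/cards1P; rewrite -(eqn_add2l #|F :&: T|) cardsID (setIidPr TF) Fd -Td addn1.
  by rewrite eqxx.
have [y [yF y1 y0 [_ yU yM]]] := chain_prime_element (ltnW r1).
have vT : v \notin T by have : v \in F :\: T; [rewrite vE inE|case/setDP].
(* Setting 'X_v to 0 restricts y to T, which gives 0, so 'X_v divides y. As y is prime and 'X_v is
   no unit, y divides 'X_v in turn. *)
have q1v : q 1%N 'X_v.
  have [|c yE] := @restr_setC1_divides k n v y.
    rewrite -[X in restr _ X]yF restr_restr (_ : _ :&: F = T); first exact/p0/(qp _ _ y1).
    rewrite setIC -setDE -vE setDDr setDv set0U; exact/setIidPr.
  have [|[e vE']|[e cE]] := yM 'X_v c; first by exists 1; rewrite mulr1.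
    by rewrite vE' mulrC; apply: primeMl (qP 1%N) _ _ y1.
  have vU : 'X_v * e = 1 by apply: (mulfI y0); rewrite mulr1 {2}yE cE; ring.
  by case: (prime1 pP); rewrite -vU mulrC; apply: (primeMl pP); move: vT; rewrite inE negbK.
(* Now q 1 contains all variables outside T, and b restricts to 0 on T; hence b is in q 1, a
   contradiction. *)
have [b [bF b2 b1]] := chain_step r1; apply: b1.
have b0 : restr T b = 0 by apply/p0/(qp 2%N).
apply/(prime_restr (F := T) (qP 1%N)); last by rewrite b0; apply: prime0 (qP 1%N).
move=> j jT; case: (boolP (j \in F)) => jF; last by apply: chain_vars => //; apply: ltnW.
by have : j \in F :\: T; [rewrite inE jT|rewrite vE inE => /eqP->].
Qed.

End Chain.

(** For chains of length 1, y is a prime element in the variables of T if |T| = d, and the outer sum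
    otherwise. For length 2 the cases |T| = d, |T| = d - 1 and |T| <= d - 2 are [regular_inner],
    [regular_inner_outer] and [regular_outer]. *)
Lemma layer_serre2 : serre 2 M.
Proof.
have [gens span] := rep_span repP.
apply: (serre2_criterion span) => p q qc; have [qP qS _ qp _] := qc;
  have [F [FD Fd TF Fq]] := chain_facet qc; have := subset_leq_card TF; rewrite Fd;
  rewrite leq_eqVlt => /predU1P[Td|Td].
- have FT : F = outside p by apply/esym/eqP; rewrite eqEcard TF Fd Td leqnn.
  have [y [yF y1 y0 _]] := chain_prime_element qc Fq isT.
  exists y; first exact: (qp _ _ y1).
  apply: nzd_at_outside => G [_ TG _] _; rewrite -yF restr_sub ?yF //.
  by rewrite FT.
- exists (outer_sum k (outside p)); first exact: outer_sum_in.
  apply: nzd_at_outside => G [_ TG _] Gd.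
  have [|i [iG iT]] := outer_vertex TG; first by rewrite Gd.
  exact: restr_outer_sum_neq0 iG iT.
- have FT : F = outside p by apply/esym/eqP; rewrite eqEcard TF Fd Td leqnn.
  have [y [yF y1 y0 yP]] := chain_prime_element qc Fq isT.
  have [z [zF z2 z1]] := chain_step qc Fq (isT : (1 < 2)%N).
  apply: (@regular_inner p y z) => //; rewrite -?FT //; [exact: (qp _ _ y1)|exact: (qp _ _ z2)|].
  by move=> [c zE]; apply: z1; rewrite zE mulrC; apply: primeMl (qP 1%N) _ _ y1.
move: Td; rewrite leq_eqVlt => /predU1P[Td|Td]; last first.
  by apply: regular_outer; rewrite addn2.
have [y [yp yT y0]] := chain_inner_element qc Fd TF Fq isT Td.
by apply: (regular_inner_outer _ yp yT y0); rewrite -Td.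
Qed.

End LayerSerre.

(** * Dimension of a layer module *)

Section FacePrime.
Variables (k : fieldType) (n : nat) (F : {set 'I_n}).

(** The prime ideal generated by the variables outside F, described as the kernel of the
    restriction. *)
Definition face_prime : {pred {mpoly k[n]}} := fun f => restr F f == 0.

Lemma face_primeE f : (f \in face_prime) = (restr F f == 0).
Proof. by []. Qed.

Lemma face_prime_idealr : idealr_closed face_prime.
Proof.
split=> [||a u v]; rewrite !face_primeE ?rmorph0 ?rmorph1 ?oner_eq0 //.
by move=> /eqP u0 /eqP v0; rewrite rmorphD rmorphM /= u0 v0 mulr0 addr0.
Qed.

Lemma face_prime_prime : prime_idealr_closed face_prime.
Proof. by move=> u v; rewrite !face_primeE rmorphM mulf_eq0. Qed.

HB.instance Definition _ := isIdealr.Build _ face_prime face_prime_idealr.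
HB.instance Definition _ := isPrimeIdealrClosed.Build _ face_prime face_prime_prime.

End FacePrime.

Section LayerDim.
Variables (k : fieldType) (n : nat) (D : {set {set 'I_n}}) (d : nat).
Hypothesis D_closed : forall F G : {set 'I_n}, G \in D -> F \subset G -> F \in D.
Variables (M : lmodType {mpoly k[n]}) (rep : M -> {mpoly k[n]}).
Hypothesis repP : layer_module D d rep.

(** Above: primes containing the annihilator contain the variables outside a facet of size d, so
    [prime_chain_bound] applies. Below: the vertices of such a facet are dropped one by one, which
    gives a chain of d+1 face primes. *)
Lemma layer_dim s : s \in layer D d -> dim M = (d%:Z)%:E.
Proof.
move=> /layer_facet[F [FD FG _ Fd]]; apply/le_anti/andP; split.
  apply: nat_sup_le => r [P [PA PS]].
  have pP i := prime_idealr_is_prime (P i).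
  have [G [_ _ <- Gq]] := annihilator_facet repP (pP 0%N) PA.
  apply: (prime_chain_bound (q := fun i a => a \in P i)) => //.
    by move=> i a /PS[+ _]; apply.
  by move=> i /PS[_ [a a1 /negP a0]]; exists a.
apply: nat_sup_ge; pose G i := [set x in drop i (enum F)].
have sF : size (enum F) = d by rewrite -cardE.
exists (fun i => face_prime (G i) : prime_idealr {mpoly k[n]}); split.
  move=> a aM; rewrite face_primeE; have -> : G 0%N = F.
    by apply/setP => x; rewrite inE drop0 mem_enum.
  have [u uE] := rep_surj repP (varprod k F).
  have : restr F (rep (a *: u)) = 0 by rewrite aM (rep0 repP) rmorph0.
  rewrite (restr_rep D_closed repP) ?Fd // uE.
  rewrite (_ : trunc _ _ = varprod k F) ?restr_varprod ?subxx.
    by move=> /eqP; rewrite mulf_eq0 (negPf (varprod_neq0 k F)) orbF.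
  apply: trunc_id => m; rewrite varprodE mcoeffX.
  by case: (_ =P m) => [<- _|_]; rewrite ?eqxx // mset_varprod.
move=> i id; have iF : (i < size (enum F))%N by rewrite sF.
have x0 : 'I_n by case: (enum F) iF => // x.
have GE := drop_nth x0 iF; set x := nth x0 _ _ in GE.
have := drop_uniq i (enum_uniq F); rewrite GE /= => /andP[xn _].
have sub : G i.+1 \subset G i.
  by apply/subsetP => y; rewrite !inE GE inE => ->; rewrite orbT.
split=> [f|].
  by rewrite !face_primeE -(restr_id f sub) => /eqP->; rewrite rmorph0.
exists 'X_x; rewrite face_primeE restrX inE; first by rewrite (negPf xn).
rewrite GE mem_head; apply/eqP => /(congr1 (mcoeff U_(x))).
by rewrite mcoeffX eqxx mcoeff0 => /eqP; rewrite oner_eq0.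
Qed.

End LayerDim.

(** * The dimension filtration *)

Section Filtration.
Variables (k : fieldType) (n : nat) (D : simplicialComplex n).
Local Notation S := {mpoly k[n]}.
Local Notation inD := (fun s : {set 'I_n} => s \in faces D).
Local Notation max_face := (max_face (faces D)).
Implicit Types (f g : S) (s t : {set 'I_n}) (q : face_ring k D).

Lemma faces_closed (F G : {set 'I_n}) : G \in faces D -> F \subset G -> F \in faces D.
Proof. by case: D => fc fcP; exact: fcP. Qed.

Lemma SR_idealP f : (f : S^o) \in (@SR_ideal k n D) <-> trunc inD f = 0.
Proof.
split=> [/asboolP[c ->]|f0].
  rewrite raddf_sum big1 // => F FD; apply/mpolyP => m; rewrite mcoeff_trunc mcoeff0.
  case: ifP => // mD; apply/eqP/negPn/negP; rewrite mulrC.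
  by move=> /mcoeff_varprodM/(faces_closed mD); rewrite (negPf FD).
rewrite [f]sum_trunc_pred1; apply: SR_ideal_sum => s _.
case: (boolP (s \in faces D)) => sD.
  rewrite (_ : trunc _ f = 0); first exact: (@rpred0 S^o (@SR_ideal k n D)).
  apply/mpolyP => m; rewrite mcoeff_trunc mcoeff0 /=; case: eqP => // ms.
  by have := congr1 (mcoeff m) f0; rewrite mcoeff_trunc mcoeff0 ms sD.
by have [c ->] := trunc_pred1_varprod s f; apply/SR_idealMl/sqfree_SR.
Qed.

(** The unique representative supported on faces; by [face_nfE] the chosen preimage does not
    matter. *)
Definition face_nf q : S := trunc inD (projT1 (cid (face_piP q))).

Lemma face_nfE f : face_nf (face_pi D f) = trunc inD f.
Proof.
rewrite /face_nf; case: cid => g /= /esym/quotmod_eq/SR_idealP.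
by rewrite raddfB => /eqP; rewrite subr_eq0 => /eqP.
Qed.

Lemma face_nfK q : face_pi D (face_nf q) = q.
Proof.
have [f ->] := face_piP q; rewrite face_nfE; apply/quotmod_eq/SR_idealP.
rewrite raddfB /= trunc_trunc (_ : (fun s => _) = inD) ?subrr //.
by apply/funext => s; rewrite andbb.
Qed.

Lemma face_nfB : zmod_morphism face_nf.
Proof.
move=> p q; have [f ->] := face_piP p; have [g ->] := face_piP q.
rewrite -[_ - _](raddfB (quotmod_pi (@SR_ideal k n D))) -/(face_pi D (f - g)).
by rewrite !face_nfE raddfB.
Qed.

HB.instance Definition _ := GRing.isZmodMorphism.Build _ _ face_nf face_nfB.

Lemma face_nfZ f q : face_nf (f *: q) = trunc inD (f * face_nf q).
Proof. by rewrite -{1}[q]face_nfK face_piZ face_nfE. Qed.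

Lemma face_nf_supp q m : (face_nf q)@_m != 0 -> mset m \in faces D.
Proof. by rewrite mcoeff_trunc; case: ifP => //; rewrite eqxx. Qed.

Definition filt e : {pred face_ring k D} :=
  fun q => `[< forall m, (face_nf q)@_m != 0 -> (max_face (mset m) < e)%N >].

Lemma filtP e q :
  reflect (forall m, (face_nf q)@_m != 0 -> (max_face (mset m) < e)%N) (q \in filt e).
Proof. exact: asboolP. Qed.

(** Enlarging a support can only lower [max_face]; this makes [filt] a submodule. *)
Lemma max_face_mulr f g e m : (forall m, g@_m != 0 -> (max_face (mset m) < e)%N) ->
  (f * g)@_m != 0 -> (max_face (mset m) < e)%N.
Proof.
move=> ge /mcoeffM_neq0[m1 [m2 [-> _ /ge]]]; apply: leq_ltn_trans.
by apply: max_face_anti; rewrite msetD subsetUr.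
Qed.

Lemma filt_closed e : submod_closed (filt e).
Proof.
split=> [|a x y /filtP xe /filtP ye].
  by apply/filtP => m; rewrite raddf0 mcoeff0 eqxx.
apply/filtP => m; rewrite -[y]opprK raddfB /= raddfN /= face_nfZ opprK mcoeffD mcoeff_trunc.
case: (boolP ((face_nf y)@_m == 0)) => [/eqP->|/ye//]; rewrite addr0.
by case: ifP => [_|_]; [apply: max_face_mulr|rewrite eqxx].
Qed.

HB.instance Definition _ e :=
  GRing.isSubmodClosed.Build S (face_ring k D) (filt e) (filt_closed e).

Lemma filt_graded e : @graded_submodule k n (face_ring_graded k D) (filt e).
Proof.
move=> x /filtP xe; pose f := face_nf x.
pose c (i : int) := face_pi D (if i is Posz j then pihomog mdeg j f else 0).
exists [seq Posz j | j <- iota 0 (msize f)], c; split.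
  move=> i; split.
    apply/asboolP; eexists; last by reflexivity.
    by case: i => i /=; rewrite ?pihomogP.
  apply/filtP => m; rewrite /c face_nfE mcoeff_trunc; case: ifP => _; last by rewrite eqxx.
  case: i => j; last by rewrite mcoeff0 eqxx.
  move=> h; apply: xe; apply: contraNneq h => h.
  rewrite pihomogE raddf_sum big1_seq //= => m' /andP[_ m'f]; rewrite mcoeffZ mcoeffX.
  by case: eqP => [mm'|]; rewrite ?mulr0 // mm' h mul0r.
rewrite big_map -[X in iota _ X]subn0 big_mkord /c -face_pi_sum.
by rewrite -(pihomog_partitionE (mf := mdeg)) // face_nfK.
Qed.

Section Layer.
Variables (e e' d : nat).
Hypothesis ed : forall s, s \in faces D -> (e <= max_face s < e')%N = (max_face s == d).
Local Notation Gam := (layer (faces D) d).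
Local Notation inGam := (fun s : {set 'I_n} => s \in Gam).
Local Notation Q := (subquot (filt e') (filt e)).

Lemma trunc_layer_filt (x : face_ring k D) f : x \in filt e -> trunc inGam (f * face_nf x) = 0.
Proof.
move=> /filtP xe; apply/mpolyP => m; rewrite mcoeff_trunc mcoeff0; case: ifP => //.
rewrite inE => /andP[mD]; rewrite -ed // => /andP[em _].
by apply/eqP/negPn/negP => /(max_face_mulr xe); rewrite ltnNge em.
Qed.

(** The layer part of a normal form; well defined by [trunc_layer_filt], since elements of [filt e]
    have no monomials in the layer. *)
Definition subquot_rep (x : Q) : S :=
  trunc inGam (face_nf (val (projT1 (cid (quotmod_piP x))))).

Local Notation Qpi := (quotmod_pi (submod_trace (N := filt e') (filt e))).

Lemma subquot_repE y : subquot_rep (Qpi y) = trunc inGam (face_nf (val y)).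
Proof.
rewrite /subquot_rep; case: cid => y' yE; rewrite [projT1 _]/=.
move: yE => /quotmod_eq; rewrite unfold_in /submod_trace GRing.valB.
move=> /(trunc_layer_filt 1); rewrite mul1r !raddfB /= => /eqP.
by rewrite subr_eq0 => /eqP.
Qed.

Lemma subquot_layer : layer_module (faces D) d subquot_rep.
Proof.
have GamD : (fun s => inGam s && inD s) = inGam.
  by apply/funext => s; rewrite inE; case: (s \in faces D); rewrite ?andbT ?andbF.
split.
- move=> p q; have [x ->] := quotmod_piP p; have [y ->] := quotmod_piP q.
  by rewrite -raddfB !subquot_repE GRing.valB !raddfB.
- move=> f p; have [x ->] := quotmod_piP p.
  rewrite -linearZ !subquot_repE GRing.valZ face_nfZ trunc_trunc GamD.
  (* What truncation removes from g has [max_face] below e, and so have its multiples; hence they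
     contribute nothing to the layer. *)
  set g := face_nf _; apply/eqP; rewrite -subr_eq0 -raddfB -mulrBr; apply/eqP/mpolyP => m.
  rewrite mcoeff_trunc mcoeff0; case: ifP => //.
  rewrite inE => /andP[mD]; rewrite -ed // => /andP[em _].
  apply/eqP/negPn/negP => gm; suff: (max_face (mset m) < e)%N by rewrite ltnNge em.
  apply: max_face_mulr gm => m'; rewrite mcoeffB mcoeff_trunc.
  case: ifPn => [_|]; first by rewrite subrr eqxx.
  rewrite subr0 => m'G gm'; have m'D := face_nf_supp gm'.
  rewrite ltnNge; apply: contra m'G => em'; rewrite inE m'D -ed // em' /=.
  by have /filtP := valP x; apply.
- move=> p; have [x ->] := quotmod_piP p; rewrite subquot_repE => x0.
  rewrite -(raddf0 Qpi); apply/quotmod_eq; rewrite subr0 unfold_in; apply/filtP => m xm.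
  have mD := face_nf_supp xm; rewrite ltnNge; apply: contra xm => em.
  have := congr1 (mcoeff m) x0; rewrite mcoeff_trunc mcoeff0 inE mD -ed // em /=.
  case: ltnP => [_ ->|]; first by rewrite eqxx.
  move=> e'm _; apply: contraT => xm; have /filtP/(_ m xm) := valP x.
  by rewrite ltnNge e'm.
move=> f; have fF : face_pi D (trunc inGam f) \in filt e'.
  apply/filtP => m; rewrite face_nfE mcoeff_trunc; case: ifP => mD; last by rewrite eqxx.
  rewrite mcoeff_trunc inE mD /=; case: ifP; last by rewrite eqxx.
  by rewrite -ed // => /andP[].
exists (Qpi (exist (fun x => x \in filt e') _ fF)); rewrite subquot_repE /= face_nfE.
apply/mpolyP => m; rewrite !mcoeff_trunc; case: ifP => // mG.
have mD : mset m \in faces D by move: mG; rewrite inE => /andP[].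
by rewrite mD ?mG.
Qed.

End Layer.

(** The sizes of the facets in increasing order. *)
Definition face_sizes : seq nat :=
  [seq x <- iota 0 n.+1 | [exists s, (s \in faces D) && (max_face s == x)]].

Lemma max_face_size s : (max_face s <= n)%N.
Proof.
by apply/bigmax_leqP => F _; rewrite -[X in (_ <= X)%N]card_ord max_card.
Qed.

Lemma face_sizesP x : reflect (exists2 s, s \in faces D & max_face s = x) (x \in face_sizes).
Proof.
rewrite mem_filter mem_iota; apply: (iffP andP) => [[/existsP[s /andP[sD /eqP]]]|[s sD <-]].
  by exists s.
rewrite ltnS max_face_size; split=> //; apply/existsP; exists s.
by rewrite sD eqxx.
Qed.

(** The default n+1 exceeds every face size, so the last filtration step is the whole face ring. *)
Definition threshold i := nth n.+1 face_sizes i.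

Lemma threshold_mono i j : (i < j)%N -> (j < size face_sizes)%N -> (threshold i < threshold j)%N.
Proof.
move=> ij js; apply: (sorted_ltn_nth ltn_trans) => //; last exact: ltn_trans js.
by apply: sorted_filter; [exact: ltn_trans|exact: iota_ltn_sorted].
Qed.

Lemma threshold_lt i : (i < size face_sizes)%N -> (threshold i < threshold i.+1)%N.
Proof.
move=> ir; case: (ltnP i.+1 (size face_sizes)) => i1r; first exact: threshold_mono.
rewrite [threshold i.+1]nth_default // ltnS.
by have /face_sizesP[t _] := mem_nth n.+1 ir; rewrite -/(threshold i) => <-; apply: max_face_size.
Qed.

Lemma threshold_layer i s : (i < size face_sizes)%N -> s \in faces D ->
  (threshold i <= max_face s < threshold i.+1)%N = (max_face s == threshold i).
Proof.
move=> ir sD; have sS : max_face s \in face_sizes by apply/face_sizesP; exists s.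
have [j jr <-] : exists2 j, (j < size face_sizes)%N & threshold j = max_face s.
  by exists (index (max_face s) face_sizes); rewrite ?index_mem // /threshold nth_index.
case: (ltngtP i j) => [ij|ji|->]; last by rewrite threshold_lt // leqnn eqxx.
  have lt := threshold_mono ij jr; rewrite (gtn_eqF lt) ltnW //=.
  move: ij; rewrite leq_eqVlt => /predU1P[->|ij]; first by rewrite ltnn.
  by rewrite ltnNge ltnW // threshold_mono.
have lt := threshold_mono ji ir.
by rewrite leqNgt lt /= (ltn_eqF lt).
Qed.

(** Consecutive thresholds enclose exactly one facet size d, so each quotient is a layer module: it
    is S_2 by [layer_serre2] and has dimension d by [layer_dim], which increases strictly. *)
Lemma connected_complex_sequentially_S2 :
  (forall d A B, A \in faces D -> B \in faces D ->
    (d <= #|A|)%N -> (d <= #|B|)%N -> (#|A :&: B| + 2 <= d)%N ->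
    exists C, [/\ C \in faces D, (d <= #|C|)%N, A :&: B \subset C,
      A :&: B \proper A :&: C & A :&: B \proper C :&: B]) ->
  complex_sequentially_S k D 2.
Proof.
move=> conn; pose F i : submodClosed (face_ring_graded k D) := filt (threshold i).
have lay i : (i < size face_sizes)%N ->
    layer_module (faces D) (threshold i) (@subquot_rep (threshold i) (threshold i.+1) (threshold i)).
  by move=> ir; apply: subquot_layer => s sD; apply: threshold_layer.
have layN i : (i < size face_sizes)%N -> exists s, s \in layer (faces D) (threshold i).
  move=> ir; have /face_sizesP[s sD sE] := mem_nth n.+1 ir.
  by exists s; rewrite inE sD; apply/eqP.
exists (size face_sizes), F; split.
- split=> q; last first.
    apply/filtP => m qm; rewrite /threshold nth_default // ltnS.
    exact: max_face_size.
  apply/idP/idP.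
  + move=> /filtP q0; rewrite inE -[q]face_nfK (_ : face_nf q = 0).
      by rewrite /face_pi raddf0.
    apply/mpolyP => m; rewrite mcoeff0; apply/eqP/negPn/negP => qm.
    (* The first threshold is the least value of [max_face], so no monomial lies below it. *)
    have mD := face_nf_supp qm; have := q0 m qm.
    have sS : max_face (mset m) \in face_sizes by apply/face_sizesP; exists (mset m).
    have js : (index (max_face (mset m)) face_sizes < size face_sizes)%N by rewrite index_mem.
    rewrite -(nth_index n.+1 sS) -/(threshold _).
    case: (posnP (index (max_face (mset m)) face_sizes)) => [->|j0]; first by rewrite ltnn.
    by rewrite ltnNge ltnW // threshold_mono.
  + by rewrite inE => /eqP->; apply: rpred0.
- by move=> i _; apply: filt_graded.
- move=> i ir; split.
    move=> q /filtP qi; apply/filtP => m /qi lt.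
    exact: ltn_trans lt (threshold_lt ir).
  have [s] := layN i ir; rewrite inE => /andP[sD /eqP sE].
  (* The squarefree monomial of a face in the layer shows that the inclusion is strict. *)
  have nf : face_nf (face_pi D (varprod k s)) = varprod k s.
    rewrite face_nfE trunc_id // => m; rewrite varprodE mcoeffX.
    by case: (_ =P m) => [<- _|_]; rewrite ?eqxx // mset_varprod.
  exists (face_pi D (varprod k s)).
    apply/filtP => m; rewrite nf varprodE mcoeffX.
    by case: (_ =P m) => [<- _|_]; rewrite ?eqxx // mset_varprod sE threshold_lt.
  apply/filtP => /(_ (\sum_(j in s) U_(j))%MM).
  by rewrite nf varprodE mcoeffX eqxx oner_eq0 mset_varprod sE ltnn => /(_ isT).
- move=> i ir; apply: (layer_serre2 _ _ (lay i ir)); first exact: faces_closed.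
  exact: conn.
move=> i ir; have [s sL] := layN _ (ltnW ir); have [s' s'L] := layN _ ir.
rewrite (layer_dim faces_closed (lay _ (ltnW ir)) sL) (layer_dim faces_closed (lay _ ir) s'L).
by rewrite lte_fin ltz_nat threshold_mono.
Qed.

End Filtration.

Local Close Scope ring_scope.

Theorem corollary4p10 (k : fieldType) (n : nat) (e : rel 'I_n)
    (e_sym : symmetric e) (e_irr : irreflexive e)
    (no_even : ~ exists c : seq 'I_n, chordless_cycle e c /\ ~~ odd (size c)) :
  graph_sequentially_S e k 2.
Proof.
apply: connected_complex_sequentially_S2 => d A B Ai Bi.
exact: independent_connected.
Qed.
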